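(* For any integer $m \geq 1$, $$T(\overline{2}, \{1\}_{2m-1}, \overline{1}) = \sum_{\substack{r+p+2k=2m \\ r,p,k\geq0}} 4 (-1)^{r+k} \beta(r+1) \beta(p+1) \cdot \frac{1}{(2k)!} \Big( \frac{\pi}{2} \Big)^{2k} .$$ In particular, $T(\overline{2}, \{1\}_{2m-1}, \overline{1}) \in \mathbb{Q}[\pi^2, \beta(\mathrm{even})]$, the $\mathbb{Q}$-subalgebra of $\mathbb{R}$ generated by $\pi^2$ and the values $\beta(2k)$, $k\ge1$.
   Context: $\beta(s)=\sum_{n\ge1}(-1)^{n-1}(2n-1)^{-s}$ is the Dirichlet beta function. $\{1\}_n$ denotes $1$ repeated $n$ times. The multiple $T$ value in question is $$T(\overline2,\{1\}_{2m-1},\overline1)=2^{2m+1}\sum_{\substack{n_1>n_2>\cdots>n_{2m+1}>0\\ n_1,n_3,\ldots,n_{2m+1}\text{ odd}\\ n_2,n_4,\ldots,n_{2m}\text{ even}}}\frac{(-1)^{(n_1-1)/2}(-1)^{(n_{2m+1}-1)/2}}{n_1^2n_2\cdots n_{2m+1}}.$$ *)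

(* Defs.v *)
From HB Require Import structures.
From mathcomp Require Import all_boot all_order all_algebra.
From mathcomp Require Import all_classical all_reals all_analysis.
From mathcomp Require Import lra ring.

Set Implicit Arguments.
Unset Strict Implicit.
Unset Printing Implicit Defensive.

Import Order.TTheory GRing.Theory Num.Theory.
Import numFieldNormedType.Exports.

Local Open Scope classical_set_scope.
Local Open Scope ring_scope.

(* The summation index is shifted by one: the n-th term is that of 2n + 1.    *)
(* The partial sums converge for every s > 0, conditionally when s = 1        *)
(* (dirichlet_beta_is_cvg).                                                   *)
Definition dirichlet_beta (R : realType) (s : nat) : R :=
  limn (series (fun n : nat => (-1) ^+ n / (n.*2.+1)%:R ^+ s : R)).

(* Positions are counted from 0, so that n i is the summation variable with   *)
(* subscript i + 1: it has to be odd when i is even and even when i is odd.   *)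
Definition multT_index (m N : nat) (n : {ffun 'I_(2 * m).+1 -> 'I_N}) : bool :=
  [&& [forall i : 'I_(2 * m).+1, forall j : 'I_(2 * m).+1,
         (i < j)%N ==> (n j < n i)%N],
      [forall i : 'I_(2 * m).+1, (0 < n i)%N] &
      [forall i : 'I_(2 * m).+1, odd (n i) == ~~ odd i]].

Definition multT_term (R : realType) (m N : nat)
    (n : {ffun 'I_(2 * m).+1 -> 'I_N}) : R :=
  (-1) ^+ (n ord0).-1./2 * (-1) ^+ (n ord_max).-1./2 /
  ((n ord0)%:R ^+ 2 * \prod_(i | i != ord0) (n i)%:R).

Definition multT_partial (R : realType) (m N : nat) : R :=
  \sum_(n : {ffun 'I_(2 * m).+1 -> 'I_N} | multT_index n) multT_term R n.

(* T(\bar 2, {1}_{2m-1}, \bar 1), as the limit of the sums over n_1 < N; the  *)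
(* multiple series converges absolutely (multT_abs_bounded), so that the      *)
(* order of summation is irrelevant.                                          *)
Definition multT (R : realType) (m : nat) : R :=
  2 ^+ (2 * m).+1 * limn (multT_partial R m).

Definition rat_subalgebra (R : realType) (S : set R) : Prop :=
  [/\ S 1,
      forall (q : rat) (x y : R), S x -> S y -> S (ratr q * x + y) &
      forall x y : R, S x -> S y -> S (x * y)].

Definition rat_subalgebra_gen (R : realType) (G : set R) : set R :=
  smallest (@rat_subalgebra R) G.

Lemma alternating_sum_bound (R : realType) (a : nat -> R) (n : nat) :
  (forall k, 0 <= a k) -> (forall k, a k.+1 <= a k) ->
  forall m, 0 <= \sum_(m <= k < m + n) (-1) ^+ (k - m) * a k <= a m.
Proof.
move=> a0 ad; elim: n => [|n IH] m; first by rewrite addn0 big_geq// lexx a0.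
rewrite big_ltn ?addnS ?ltnS ?leq_addr// subnn expr0 mul1r.
have -> : \sum_(m.+1 <= k < (m + n).+1) (-1) ^+ (k - m) * a k =
          - \sum_(m.+1 <= k < m.+1 + n) (-1) ^+ (k - m.+1) * a k.
  rewrite addSn -sumrN; apply: eq_big_nat => k /andP[mk _].
  by rewrite -(subnSK mk) exprS mulN1r mulNr.
by have := IH m.+1; have := ad m; have := a0 m; lra.
Qed.

Lemma dirichlet_beta_is_cvg (R : realType) (s : nat) : (0 < s)%N ->
  cvgn (series (fun n : nat => (-1) ^+ n / (n.*2.+1)%:R ^+ s : R)).
Proof.
move=> s0; set a := fun n : nat => ((n.*2.+1)%:R ^+ s)^-1 : R.
have a0 k : 0 <= a k by rewrite invr_ge0 exprn_ge0.
have ad k : a k.+1 <= a k.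
  by rewrite lef_pV2 ?posrE ?exprn_gt0 ?ltr0n// lerXn2r ?nnegrE ?ler0n// ler_nat ltnS leq_double.
have bnd m n : (m <= n)%N -> `|\sum_(m <= k < n) (-1) ^+ k * a k| <= a m.
  move=> mn; have := alternating_sum_bound (n - m) a0 ad m.
  rewrite subnKC// => /andP[h1 h2].
  have -> : \sum_(m <= k < n) (-1) ^+ k * a k =
      (-1) ^+ m * \sum_(m <= k < n) (-1) ^+ (k - m) * a k.
    rewrite big_distrr/=; apply: eq_big_nat => k /andP[mk _].
    by rewrite mulrA -exprD subnKC.
  by rewrite normrM normrX normrN1 expr1n mul1r ger0_norm.
have ah k : a k <= harmonic k.
  rewrite /harmonic/= lef_pV2 ?posrE ?exprn_gt0 ?ltr0n//.
  have k1 : (k.+1%:R : R) <= (k.*2.+1)%:R by rewrite ler_nat ltnS -addnn leq_addr.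
  apply: (le_trans k1); case: s s0 {a a0 ad bnd} => // s _.
  by rewrite exprS ler_peMr// exprn_ege1// ler1n.
apply/cauchy_cvgP/cauchy_seriesP => e e0.
have [N _ HN] : \forall n \near \oo, harmonic n < e.
  exact: (@cvgr_lt R _ _ _ harmonic _ (@cvg_harmonic R)).
exists ([set k | (N <= k)%N], [set k | (N <= k)%N]); first by split; exists N.
move=> [m n] /= [mN nN]; case: (leqP m n) => [mn|/ltnW nm].
  by apply: le_lt_trans (bnd _ _ mn) _; apply: le_lt_trans (ah m) _; exact: HN.
by rewrite big_geq// normr0.
Qed.

Lemma telescope_bound (R : realType) (e : R) (k : nat) : 0 < e ->
  (k.+2%:R `^ (1 + e))^-1 <= e^-1 * ((k.+1%:R `^ e)^-1 - (k.+2%:R `^ e)^-1).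
Proof.
move=> e0.
have p1 : (0 : R) < k.+1%:R by rewrite ltr0n.
have p2 : (0 : R) < k.+2%:R by rewrite ltr0n.
have P1 := powR_gt0 e p1. have P2 := powR_gt0 e p2.
rewrite powRD; last by rewrite gt_eqF ?addr_gt0.
rewrite (powRr1 (ltW p2)) invfM (ler_pdivlMl _ _ e0).
have -> : (k.+1%:R `^ e)^-1 = (k.+2%:R `^ e)^-1 * expR (e * (ln k.+2%:R - ln k.+1%:R)).
  rewrite /powR !gt_eqF// -!expRN -expRD; congr expR; ring.
rewrite mulrA [leLHS]mulrC -[X in _ <= _ - X]mulr1 -mulrBr ler_pM2l ?invr_gt0//.
rewrite lerBrDl; apply: le_trans (expR_ge1Dx _); rewrite lerD2l ler_pM2l//.
have := @le_ln1Dx R (- k.+2%:R^-1).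
have -> : 1 - k.+2%:R^-1 = k.+1%:R / k.+2%:R :> R.
  rewrite -[X in X - _](divff (lt0r_neq0 p2)) -[X in _ - X]mul1r -mulrBl.
  by congr (_ / _); rewrite -[k.+2%:R]natr1 addrK.
rewrite ltrN2 invf_lt1// ltr1n => /(_ isT).
by rewrite ln_div ?posrE// lerNr opprB.
Qed.

Lemma pseries_bounded (R : realType) (e : R) : 0 < e -> exists M : R, forall N : nat,
  \sum_(k < N) (k%:R `^ (1 + e))^-1 <= M.
Proof.
move=> e0; exists (1 + e^-1) => N.
have ge0 k : 0 <= (k%:R `^ (1 + e))^-1 :> R by rewrite invr_ge0 powR_ge0.
suff : \sum_(k < N.+2) (k%:R `^ (1 + e))^-1 <= 1 + e^-1 * (1 - (N.+1%:R `^ e)^-1).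
  rewrite 2!big_ord_recr/= => h.
  have h1 : e^-1 * (1 - (N.+1%:R `^ e)^-1) <= e^-1.
    by rewrite ler_piMr ?invr_ge0 ?(ltW e0)// gerBl invr_ge0 powR_ge0.
  by have := ge0 N; have := ge0 N.+1; lra.
elim: N => [|N IH].
  rewrite 2!big_ord_recr big_ord0/= powR0 ?gt_eqF ?addr_gt0// invr0 !add0r.
  by rewrite !powR1 invr1 subrr mulr0 addr0.
rewrite big_ord_recr/=; apply: le_trans (lerD IH (telescope_bound N e0)) _.
by rewrite -addrA -mulrDr addrA subrK.
Qed.

Lemma multT_term_bound (R : realType) (m N : nat)
    (n : {ffun 'I_(2 * m).+1 -> 'I_N}) : multT_index n ->
  `|multT_term R n| <= \prod_i ((n i)%:R `^ (1 + (2 * m).+1%:R^-1))^-1.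
Proof.
move=> /and3P[/forallP dec /forallP pos _].
set e : R := _^-1.
have e0 : 0 < e by rewrite invr_gt0 ltr0n.
have le0 i : (n i <= n ord0)%N.
  have [->//|i0] := eqVneq i ord0.
  have /forallP/(_ i)/implyP h := dec ord0.
  by apply/ltnW/h; rewrite /= lt0n; move: i0; rewrite -val_eqE.
have P i : 0 < (n i)%:R :> R by rewrite ltr0n.
rewrite /multT_term !normrM !normrX normrN1 !expr1n !mul1r.
rewrite prodfV normfV lef_pV2 ?posrE; last 2 first.
- by rewrite normr_gt0 mulf_neq0 ?expf_neq0 ?gt_eqF ?prodr_gt0.
- by apply: prodr_gt0 => i _; rewrite powR_gt0.
rewrite ger0_norm; last by rewrite mulr_ge0 ?exprn_ge0 ?prodr_ge0.
have powE i : (n i)%:R `^ (1 + e) = (n i)%:R * (n i)%:R `^ e.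
  by rewrite powRD ?(powRr1 (ltW (P i)))// (gt_eqF (P i)) implybT.
rewrite (eq_bigr _ (fun i _ => powE i)).
rewrite big_split/= [X in X * _](bigD1 ord0)//= expr2 -[leRHS]mulrA [leRHS]mulrC.
rewrite ler_pM2l ?mulr_gt0 ?prodr_gt0//.
apply: (@le_trans _ _ (\prod_(i < (2 * m).+1) ((n ord0)%:R `^ e))).
  apply: ler_prod => i _; rewrite powR_ge0/= ge0_ler_powR ?(ltW e0) ?nnegrE ?ler0n//.
  by rewrite ler_nat.
rewrite prodr_const card_ord -powR_mulrn ?powR_ge0// -powRrM mulVf ?pnatr_eq0//.
by rewrite powRr1.
Qed.

Lemma multT_abs_bounded (R : realType) (m : nat) : exists M : R, forall N : nat,
  \sum_(n : {ffun 'I_(2 * m).+1 -> 'I_N} | multT_index n) `|multT_term R n| <= M.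
Proof.
have [|M HM] := @pseries_bounded R (2 * m).+1%:R^-1; first by rewrite invr_gt0.
exists (M ^+ (2 * m).+1) => N.
set e := _^-1 in HM.
have ge0 k : 0 <= (k%:R `^ (1 + e))^-1 :> R by rewrite invr_ge0 powR_ge0.
apply: (@le_trans _ _ (\sum_(n : {ffun 'I_(2 * m).+1 -> 'I_N})
    \prod_i ((n i)%:R `^ (1 + e))^-1)).
  rewrite [leRHS](bigID (@multT_index m N))/= -[leLHS]addr0 lerD//.
    by apply: ler_sum => n; exact: multT_term_bound.
  by apply: sumr_ge0 => n _; apply: prodr_ge0.
rewrite -(bigA_distr_bigA (fun _ (k : 'I_N) => ((k : nat)%:R `^ (1 + e))^-1)).
rewrite prodr_const card_ord lerXn2r ?nnegrE ?sumr_ge0//.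
by apply: le_trans (HM 0%N); rewrite big_ord0.
Qed.

Lemma multT_mono (R : realType) (m N M : nat)
    (F : forall N, {ffun 'I_(2 * m).+1 -> 'I_N} -> R) (NM : (N <= M)%N) :
  (forall N n, 0 <= F N n) ->
  (forall n : {ffun 'I_(2 * m).+1 -> 'I_N}, F M [ffun i => widen_ord NM (n i)] = F N n) ->
  \sum_(n | multT_index n) F N n <= \sum_(n | multT_index n) F M n.
Proof.
move=> F0 FE; set h := fun n : {ffun 'I_(2 * m).+1 -> 'I_N} => [ffun i => widen_ord NM (n i)].
have hinj : injective h.
  move=> x y /ffunP xy; apply/ffunP => i; have := xy i; rewrite !ffunE.
  by move=> /(congr1 val)/= ?; exact: val_inj.
have hP n : multT_index (h n) = multT_index n.
  congr [&& _, _ & _]; [apply: eq_forallb => i; apply: eq_forallb => j|apply: eq_forallb => i..];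
  by rewrite !ffunE.
under eq_bigr do rewrite -FE.
rewrite -(big_imset (F M) (h := h) (A := [pred n | multT_index n]))/=; last by move=> x y _ _; exact: hinj.
rewrite [leRHS](bigID (mem (h @: [pred n | multT_index n])))/=.
rewrite -[leLHS]addr0 lerD ?sumr_ge0// le_eqVlt; apply/orP; left; apply/eqP.
apply: eq_bigl => n; apply/idP/andP => [nh|[]//]; split=> //.
by have /imsetP[x + ->] := nh; rewrite hP.
Qed.

Lemma multT_is_cvg (R : realType) (m : nat) : cvgn (multT_partial R m).
Proof.
have [M HM] := multT_abs_bounded R m.
have E N K (NK : (N <= K)%N) (n : {ffun 'I_(2 * m).+1 -> 'I_N}) :
    multT_term R [ffun i => widen_ord NK (n i)] = multT_term R n.
  rewrite /multT_term !ffunE/=; congr (_ / (_ * _)).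
  by apply: eq_bigr => i _; rewrite ffunE.
pose A N := \sum_(n : {ffun 'I_(2 * m).+1 -> 'I_N} | multT_index n) `|multT_term R n|.
pose B N := \sum_(n : {ffun 'I_(2 * m).+1 -> 'I_N} | multT_index n)
  (`|multT_term R n| + multT_term R n).
have cA : cvgn A.
  apply: nondecreasing_is_cvgn.
    by move=> N K NK; apply: (multT_mono (F := fun N n => `|multT_term R n|) (NM := NK)) => // n; rewrite E.
  by exists M => _ [N _ <-]; exact: HM.
have cB : cvgn B.
  apply: nondecreasing_is_cvgn.
    move=> N K NK; apply: (multT_mono (F := fun N n => `|multT_term R n| + multT_term R n) (NM := NK)) => //.
      by move=> ? n; have := ler_norm (- multT_term R n); rewrite normrN; lra.
    by move=> n; rewrite E.
  exists (M + M) => _ [N _ <-]; rewrite /B big_split/= lerD ?HM//.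
  by apply: le_trans (HM N); apply: ler_sum => n _; exact: ler_norm.
have -> : multT_partial R m = B - A.
  by apply/funext => N; rewrite /B /A fctE big_split/= addrC addKr.
exact: is_cvgB.
Qed.

(* Main.v *)
Require Import Defs.
From HB Require Import structures.
From mathcomp Require Import all_boot all_order all_algebra.
From mathcomp Require Import all_classical all_reals all_analysis.
From mathcomp Require Import ring lra zify.

Import Order.TTheory GRing.Theory Num.Theory.
Import numFieldNormedType.Exports.

Local Open Scope classical_set_scope.
Local Open Scope ring_scope.

(** For m >= 1, distributing the signs of n_1 and n_(2m+1) over the gaps between
    consecutive indices shows that, up to the factor (-1)^m 2^(2m+1), the
    multiple series is the sum of c_n / n, where c_n are the Taylor coefficients
    of the function g_(2m) defined by g_0' = 1 / (1 - t^2),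
    g_(j+1)' = g_j / (1 + t^2) and g_j (0) = 0 (multT_dlog). With
    t = tan (x / 2) the functions h_j = 2^(j+1) g_j are the iterated
    antiderivatives of 1 / cos x, and by absolute convergence

      multT = (-1)^m * integral over [0, pi/2] of h_(2m) (x) / sin x.

    Integrating 1 / cos x = 2 sum (-1)^n cos ((2n+1) x) from 0 repeatedly, one gets
    h_(2m) as a polynomial in x with coefficients +- 2 beta(even) / k!, plus
    2 (-1)^m sum (-1)^n sin ((2n+1) x) / (2n+1)^(2m+1). The sine terms contribute
    pi beta(2m+1), because sin ((2n+1) x) / sin x has integral pi / 2. For odd k
    the integral of x^k / (k! sin x) is, after the substitution
    pi / 2 - x and integrations by parts, h_k (pi/2), a polynomial in
    pi with coefficients +- beta(even) by the same Fourier expansion. This gives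
    the terms of the formula with r and p odd, plus pi beta(2m+1). The
    terms with r and p even also add up to pi beta(2m+1), because the
    generating series of the values beta(2k+1) is (pi / 4) / cos (pi z / 2):
    this is the vanishing at pi / 2 of the iterated antiderivatives of
    sum (-1)^n cos ((2n+1) x) / (2n+1) = pi / 4 (beta_cos_sum_even). The same
    recurrence makes beta(2k+1) a rational multiple of pi^(2k+1), hence the
    statement on the subalgebra.

    The divergent series for 1 / cos is handled through its finite partial sums:
    the N-th one differs from 1 / (2 cos x) by +- cos (2 N x) / (2 cos x), which
    one integration makes O(1 / N) on every [0, a] with a < pi / 2
    (trig_rem0_error). Functions are compared through their derivatives and the
    mean value theorem, so that the integrals above occur only as
    explicit antiderivatives. The two sides that meet in sec_sin_int_approx
    have derivatives that are uniformly O(1 / N)-close on (0, pi/2). *)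

Set Implicit Arguments.
Unset Strict Implicit.
Unset Printing Implicit Defensive.

(** * Derivatives of real functions *)

Section Derivatives.
Variable R : realType.
Implicit Types (f g : R -> R) (x a b c : R).

Lemma is_derive_add f g x a b : is_derive x 1 f a -> is_derive x 1 g b ->
  is_derive x 1 (fun y => f y + g y) (a + b).
Proof. by move=> ? ?; exact: is_deriveD. Qed.

Lemma is_derive_sub f g x a b : is_derive x 1 f a -> is_derive x 1 g b ->
  is_derive x 1 (fun y => f y - g y) (a - b).
Proof. by move=> ? ?; exact: is_deriveB. Qed.

Lemma is_derive_mul f g x a b : is_derive x 1 f a -> is_derive x 1 g b ->
  is_derive x 1 (fun y => f y * g y) (a * g x + f x * b).
Proof.
move=> ? ?; apply: (@is_derive_eq _ _ _ _ _ _ _ _ (is_deriveM _ _)).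
by rewrite addrC; congr (_ + _); rewrite /GRing.scale/= mulrC.
Qed.

Lemma is_derive_scal c f x a : is_derive x 1 f a ->
  is_derive x 1 (fun y => c * f y) (c * a).
Proof. by move=> ?; exact: is_deriveZ. Qed.

Lemma is_derive_chain f g x a b : is_derive (g x) 1 f a -> is_derive x 1 g b ->
  is_derive x 1 (fun y => f (g y)) (a * b).
Proof. by move=> ? ?; exact: (is_derive1_comp (f := f)). Qed.

Lemma is_derive_affine a b x : is_derive x 1 (fun y => a * y + b) a.
Proof.
have /is_derive_eq := is_derive_add (is_derive_scal a (is_derive_id x 1))
  (is_derive_cst b x 1).
by apply; rewrite mulr1 addr0.
Qed.

Lemma is_derive_const c x : is_derive x 1 (fun=> c) 0.
Proof. exact: is_derive_cst. Qed.

Lemma is_derive_bigsum (n : nat) (F : nat -> R -> R) (dF : nat -> R) x :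
  (forall i, (i < n)%N -> is_derive x 1 (F i) (dF i)) ->
  is_derive x 1 (fun y => \sum_(i < n) F i y) (\sum_(i < n) dF i).
Proof.
elim: n => [|n IH] dFn.
  rewrite big_ord0 [X in is_derive _ _ X](_ : _ = fun=> 0); last first.
    by apply/funext => y; rewrite big_ord0.
  exact: is_derive_const.
rewrite big_ord_recr/=.
rewrite [X in is_derive _ _ X](_ : _ = fun y => \sum_(i < n) F i y + F n y).
  by apply: is_derive_add; [apply: IH => i /ltnW|]; exact: dFn.
by apply/funext => y; rewrite big_ord_recr.
Qed.

Lemma is_derive_continuous f x d : is_derive x 1 f d -> {for x, continuous f}.
Proof. by move=> [fx _]; exact/differentiable_continuous/derivable1_diffP. Qed.

(** A bound on the derivative over a closed interval bounds the increment. *)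
Lemma increment_le f (df : R -> R) a b c : a <= b ->
  (forall x, a <= x <= b -> is_derive x 1 f (df x)) ->
  (forall x, a <= x <= b -> `|df x| <= c) ->
  `|f b - f a| <= c * (b - a).
Proof.
move=> ab fdf dfc.
have [|||z zab ->] := @MVT_segment R f df a b.
- exact: ab.
- by move=> x /[!in_itv]/= /andP[/ltW ax /ltW xb]; apply: fdf; rewrite ax.
- apply: derivable_within_continuous => x /[!in_itv]/= xab.
  by have [] := fdf x xab.
- by rewrite normrM (ger0_norm (x := b - a)) ?subr_ge0// ler_wpM2r ?subr_ge0// dfc.
Qed.

End Derivatives.

Section Trigonometry.
Variable R : realType.
Implicit Types x y : R.

Lemma pihalf_bounds : 0 < (pi / 2 : R) < 2.
Proof. exact: pihalf_02. Qed.

Lemma sin_le_id x : 0 <= x -> `|sin x| <= x.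
Proof.
move=> x0; have := @increment_le R sin cos 0 x 1 x0 (fun y _ => is_derive_sin y)
  (fun y _ => cos_max y).
by rewrite sin0 !subr0 mul1r.
Qed.

Lemma norm_sin_nat (n : nat) x : 0 <= x -> `|sin (n%:R * x)| <= n%:R * x.
Proof. by move=> x0; apply: sin_le_id; rewrite mulr_ge0. Qed.

(** A weak form of the inequality of Jordan. *)
Lemma sin_ge_half x : 0 <= x <= pi / 2 -> x / 2 <= sin x.
Proof.
move=> /andP[x0 xpi]; have := pihalf_bounds => /andP[p0 p2].
have c4 : cos (pi / 4 : R) ^+ 2 = 1 / 2.
  have := cos_mulr2n (pi / 4 : R); rewrite (_ : pi / 4 *+ 2 = pi / 2) ?cos_pihalf.
    by move=> h; lra.
  by rewrite mulr2n; field.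
have c40 : 0 < cos (pi / 4 : R) by apply: cos_gt0_pihalf; lra.
have cle y : 0 <= y <= pi / 4 -> cos (pi / 4) <= cos y.
  move=> /andP[y0 y1]; have [->//|ny] := eqVneq y (pi / 4).
  rewrite ltW// ltr_cos ?in_itv/=; last 2 first.
  - by apply/andP; split; lra.
  - by apply/andP; split; lra.
  - by rewrite lt_neqAle ny.
have x2 : 0 <= x / 2 <= pi / 4 by apply/andP; split; lra.
have sx : cos (pi / 4) * (x / 2) <= sin (x / 2).
  pose k (y : R) := sin y - (cos (pi / 4) * y + 0).
  have dk (y : R) : is_derive y 1 k (cos y - cos (pi / 4)).
    exact: is_derive_sub (is_derive_sin y) (is_derive_affine _ _ _).
  have [||z zx] := @MVT_segment R k _ 0 (x / 2) _ (fun y _ => dk y).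
  - by case/andP: x2.
  - by apply: derivable_within_continuous => y _; have [] := dk y.
  - rewrite /k sin0 mulr0 !addr0 subr0 => e.
    have : 0 <= (cos z - cos (pi / 4)) * (x / 2 - 0).
      apply: mulr_ge0; last by lra.
      by rewrite subr_ge0 cle//; move: zx; rewrite in_itv/= => /andP[? ?]; apply/andP; split; lra.
    by lra.
have := sin_mulr2n (x / 2); rewrite (_ : x / 2 *+ 2 = x); last by rewrite mulr2n; field.
move=> ->.
have := cle _ x2; set C := cos (x / 2).
set S := sin (x / 2) in sx *; set c := cos (pi / 4) in c4 c40 sx *.
move=> cC; have : c * (c * (x / 2)) <= C * S.
  apply: ler_pM => //; first exact: ltW.
  by apply: mulr_ge0; [exact: ltW|lra].
by rewrite mulrA -expr2 c4; lra.
Qed.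

Lemma sin_bounds_gt0 x : 0 < x <= pi / 2 -> 0 < sin x.
Proof. by move=> /andP[x0 xp]; have := @sin_ge_half x; rewrite (ltW x0) xp; lra. Qed.

Lemma cos_ge_half x : 0 <= x <= pi / 2 -> (pi / 2 - x) / 2 <= cos x.
Proof.
move=> xp; rewrite -[cos x]cosN -sinDpihalf; have := @sin_ge_half (- x + pi / 2).
by rewrite addrC; apply; lra.
Qed.

End Trigonometry.

(** * Power series on the unit disk *)

Section PowerSeries.
Variable R : realType.
Implicit Types (f : nat -> R) (t : R).

Lemma natmul_expr_le (x d : R) n : 0 <= x -> 0 <= d ->
  n.+1%:R * x ^+ n * d <= (x + d) ^+ n.+1.
Proof.
move=> x0 d0; elim: n => [|n IH]; first by rewrite !expr1 expr0; lra.
rewrite [leRHS]exprS [leRHS]mulrDl.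
have h1 : x * (n.+1%:R * x ^+ n * d) <= x * (x + d) ^+ n.+1 by rewrite ler_wpM2l.
have h2 : d * x ^+ n.+1 <= d * (x + d) ^+ n.+1.
  by rewrite ler_wpM2l// lerXn2r ?nnegrE ?addr_ge0// lerDl.
apply: le_trans (_ : _ <= _) (lerD h1 h2); rewrite [n.+2%:R]mulrS le_eqVlt; apply/orP; left.
by apply/eqP; rewrite exprS; ring.
Qed.

Lemma is_cvg_series_shift f : cvgn (series f) ->
  cvgn (series (fun n => f n.+1)).
Proof.
move=> fcvg; have -> : series (fun n => f n.+1) = fun n => series f n.+1 - f 0%N.
  apply/funext => n; rewrite /series/= [X in _ = X - _]big_nat_recl//.
  by rewrite addrC addKr.
apply: is_cvgB; last exact: is_cvg_cst.
by move/cvg_ex : fcvg => [l fl]; apply/cvg_ex; exists l; rewrite cvg_shiftS.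
Qed.

(** The radius of convergence is at least 1. *)
Definition cvg_in_unit_disk f := forall t, `|t| < 1 -> cvgn (pseries f t).

Lemma cvg_in_unit_disk_bounded f (c : R) : (forall n, `|f n| <= c) ->
  cvg_in_unit_disk f.
Proof.
move=> fc t t1; apply: normed_cvg.
apply: (series_le_cvg (v_ := geometric c `|t|)) => //=.
- by move=> n; rewrite mulr_ge0 ?exprn_ge0// (le_trans _ (fc n)).
- by move=> n; rewrite normrM normrX ler_wpM2r ?exprn_ge0.
- by apply: is_cvg_geometric_series; rewrite normr_id.
Qed.

Lemma cvg_in_unit_disk_diffs f : cvg_in_unit_disk f ->
  cvg_in_unit_disk (pseries_diffs f).
Proof.
move=> fcvg t t1; pose d := (1 - `|t|) / 4; pose K := `|t| + d.
have t0 : 0 <= `|t| := normr_ge0 t.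
have d0 : 0 < d by rewrite /d; lra.
have K2 : `|K + d| < 1 by rewrite ger0_norm /K /d; lra.
have := is_cvg_pseries_inside_norm (fcvg _ K2) (z := K).
have KK : `|K| < `|K + d| by rewrite !ger0_norm /K /d; lra.
move=> /(_ KK) fK; apply: normed_cvg.
have {}fK : cvgn (series (fun n => d^-1 * (`|f n.+1| * K ^+ n.+1))).
  apply: is_cvg_seriesZ; exact: is_cvg_series_shift fK.
apply: series_le_cvg fK => //= n.
- by rewrite mulr_ge0 ?invr_ge0 ?(ltW d0)// mulr_ge0// exprn_ge0// /K; lra.
- have := natmul_expr_le n t0 (ltW d0).
  rewrite -/K /pseries_diffs 2!normrM normrX ger0_norm// => h.
  rewrite ler_pdivlMl// (_ : d * _ = `|f n.+1| * (n.+1%:R * `|t| ^+ n * d)).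
    by rewrite ler_wpM2l.
  by ring.
Qed.

Lemma is_derive_pseries f t : cvg_in_unit_disk f -> `|t| < 1 ->
  is_derive t 1 (fun u => limn (pseries f u)) (limn (pseries (pseries_diffs f) t)).
Proof.
move=> fcvg t1; have df := cvg_in_unit_disk_diffs fcvg.
have ddf := cvg_in_unit_disk_diffs df.
have t0 := normr_ge0 t.
have K1 : `|(`|t| + 1) / 2| < 1 by rewrite ger0_norm; lra.
apply: (@pseries_snd_diffs _ _ ((`|t| + 1) / 2)).
- exact: fcvg.
- exact: df.
- exact: ddf.
- by rewrite [ltRHS]ger0_norm; lra.
Qed.

(** Multiplication by 1 + s t^2 seen on coefficients. *)
Lemma pseries_mul_quadratic (d e : nat -> R) (s t : R) :
  cvgn (pseries d t) -> d 0%N = e 0%N -> d 1%N = e 1%N ->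
  (forall n, d n.+2 + s * d n = e n.+2) ->
  pseries e t @ \oo --> limn (pseries d t) * (1 + s * t ^+ 2).
Proof.
move=> dcvg d0 d1 dS; rewrite -(cvg_shiftn 2).
have -> : (fun n => pseries e t (n + 2)%N) =
    (fun n => pseries d t (n + 2)%N + s * t ^+ 2 * pseries d t n).
  apply/funext => n; rewrite addn2 /pseries /series/=.
  have S2 (u : nat -> R) : \sum_(0 <= i < n.+2) u i =
      u 0%N + (u 1%N + \sum_(0 <= i < n) u i.+2) by rewrite !big_nat_recl.
  rewrite !S2 -!addrA d0 d1; congr (_ + (_ + _)); rewrite mulr_sumr -big_split/=.
  by apply: eq_bigr => i _; rewrite -dS !exprS; ring.
rewrite mulrDr mulr1 [_ * (s * _)]mulrC; apply: cvgD; last exact: cvgMl_tmp.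
by rewrite (cvg_shiftn 2 (pseries d t)).
Qed.

Lemma nondecreasing_series_norm f : nondecreasing_seq (series (fun k => `|f k|)).
Proof.
move=> m n mn; rewrite /series/= (big_cat_nat (leq0n _) mn)//= lerDl.
by apply: sumr_ge0 => k _.
Qed.

(** Left continuity at 1 of an absolutely convergent power series. *)
Lemma pseries_cvg_at_left1 f (c : R) :
  (forall n, \sum_(0 <= k < n) `|f k| <= c) ->
  limn (pseries f t) @[t --> 1^'-] --> limn (series f).
Proof.
move=> fc.
have ncvg : cvgn (series (fun k => `|f k|)).
  apply: nondecreasing_is_cvgn; first exact: nondecreasing_series_norm.
  by exists c => _ [n _ <-]; exact: fc.
have fcvg : cvgn (series f) by exact: normed_cvg.
have tail t n : 0 <= t <= 1 -> cvgn (pseries f t) /\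
    `|limn (pseries f t) - pseries f t n| <=
    limn (series (fun k => `|f k|)) - series (fun k => `|f k|) n.
  move=> /andP[t0 t1].
  have pn : cvgn (series (fun k => `|f k * t ^+ k|)).
    apply: (series_le_cvg (v_ := fun k => `|f k|)) => //= k.
    by rewrite normrM ler_piMr// normrX exprn_ile1 ?ger0_norm// normr_ge0.
  have pc : cvgn (pseries f t) by exact: normed_cvg.
  split=> //; have : `|pseries f t p - pseries f t n| @[p --> \oo] -->
      `|limn (pseries f t) - pseries f t n|.
    by apply: cvg_norm; apply: cvgB; [exact: pc|exact: cvg_cst].
  move=> h; rewrite -(cvg_lim _ h)//; apply: limr_le; first by apply: cvgP h.
  near=> p; have np : (n <= p)%N by near: p; exact: nbhs_infty_ge.
  have -> : pseries f t p - pseries f t n = \sum_(n <= k < p) f k * t ^+ k.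
    by rewrite /pseries /series/= (big_cat_nat (leq0n _) np)//= addrAC subrr add0r.
  apply: (@le_trans _ _ ((series (fun k => `|f k|)) p - (series (fun k => `|f k|)) n)).
    rewrite /series/= (big_cat_nat (leq0n _) np)//= addrAC subrr add0r.
    apply: le_trans (ler_norm_sum _ _ _) _; apply: ler_sum => k _.
    by rewrite normrM ler_piMr// normrX exprn_ile1 ?ger0_norm// normr_ge0.
  rewrite lerB//; apply: nondecreasing_cvgn_le => //.
  exact: nondecreasing_series_norm.
apply/cvgrPdist_le => e e0.
have e3 : 0 < e / 3 by lra.
have /cvgrPdist_le /(_ _ e3) [N _ /(_ N (leqnn _))/= HN] :
  series (fun k => `|f k|) n @[n --> \oo] --> limn (series (fun k => `|f k|)) by [].
have pN : pseries f t N @[t --> (1 : R)] --> pseries f 1 N.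
  rewrite /pseries /series/=; elim: N {HN} => [|N IH].
    by rewrite big_geq//; under eq_fun do rewrite big_geq//; exact: cvg_cst.
  rewrite big_nat_recr//=; under eq_fun do rewrite big_nat_recr//=.
  by apply: cvgD => //; apply: cvgMl_tmp; apply: exprn_continuous.
have {}pN : pseries f t N @[t --> (1 : R)^'-] --> pseries f 1 N.
  exact: cvg_at_left_filter.
have f1 : pseries f 1 = series f.
  by apply/funext => n; rewrite /pseries /series/=; apply: eq_bigr => k _; rewrite expr1n mulr1.
near=> t.
have t01 : 0 <= t <= 1.
  apply/andP; split; first by near: t; exact: nbhs_left_ge.
  by near: t; exact: nbhs_left_le.
have [_ h1] := tail t N t01.
have [_ h2] := tail 1 N (introT andP (conj ler01 (lexx 1))).
have h3 : `|pseries f 1 N - pseries f t N| <= e / 3.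
  by near: t; move/cvgrPdist_le : pN; exact.
have h4 : limn (series (fun k => `|f k|)) - (series (fun k => `|f k|)) N <= e / 3.
  exact: le_trans (ler_norm _) HN.
rewrite -f1.
have -> : limn (pseries f 1) - limn (pseries f t) = (limn (pseries f 1) - pseries f 1 N)
  + (pseries f 1 N - pseries f t N) - (limn (pseries f t) - pseries f t N) by ring.
apply: le_trans (ler_normB _ _) _.
have := ler_normD (limn (pseries f 1) - pseries f 1 N) (pseries f 1 N - pseries f t N).
by lra.
Unshelve. all: by end_near. Qed.

End PowerSeries.

(** * Iterated integrals as power series in tan (x / 2) *)

Section IteratedIntegrals.
Variable R : realType.
Implicit Types (j n : nat) (t x : R).

(** The coefficient of t^k in t / (1 + t^2). *)
Definition gap_sign (k : nat) : R := if odd k then (-1) ^+ k./2 else 0.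

(** The coefficients of the functions g_j given by g_0' = 1 / (1 - t^2) and
    g_(j+1)' = g_j / (1 + t^2); all of these vanish at 0. *)
Fixpoint chain_coef (j n : nat) : R :=
  if j is i.+1 then n%:R^-1 * \sum_(l < n) gap_sign (n - l) * chain_coef i l
  else (odd n)%:R / n%:R.

Lemma chain_coef0 j : chain_coef j 0 = 0.
Proof. by case: j => [|j] /=; rewrite ?big_ord0 ?mulr0 ?mul0r. Qed.

Lemma norm_gap_sign k : `|gap_sign k| <= 1.
Proof.
by rewrite /gap_sign; case: ifP => _; rewrite ?normr0 ?ler01// normrX normrN1 expr1n.
Qed.

Lemma gap_signSS k : gap_sign k.+2 = - gap_sign k.
Proof. by rewrite /gap_sign/= negbK; case: ifP => _; rewrite ?oppr0// exprS mulN1r. Qed.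

Lemma norm_chain_coef j n : `|chain_coef j n| <= 1.
Proof.
elim: j n => [|j IH] [|n]; rewrite ?chain_coef0 ?normr0 ?ler01//=.
  rewrite normrM normfV [`|n.+1%:R|]ger0_norm// ler_pdivrMr// mul1r.
  by case: (odd n); rewrite /= ?normr0 ?normr1// ler1n.
rewrite normrM normfV [`|n.+1%:R|]ger0_norm// ler_pdivrMl// mulr1.
apply: le_trans (ler_norm_sum _ _ _) _.
apply: (@le_trans _ _ (\sum_(l < n.+1) 1)); last by rewrite sumr_const card_ord.
by apply: ler_sum => l _; rewrite normrM mulr_ile1// norm_gap_sign.
Qed.

Lemma chain_coef_diffs j n : pseries_diffs (chain_coef j.+1) n =
  \sum_(l < n.+1) gap_sign (n.+1 - l) * chain_coef j l.
Proof. by rewrite /pseries_diffs/= mulVKf. Qed.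

Lemma chain_coef_rec j n : pseries_diffs (chain_coef j.+1) n.+2 +
  1 * pseries_diffs (chain_coef j.+1) n = chain_coef j n.+2.
Proof.
rewrite !chain_coef_diffs mul1r 2!big_ord_recr/= subSnn.
rewrite (_ : n.+3 - n.+1 = 2)%N; last by lia.
rewrite {2}/gap_sign/= mul0r addr0 /gap_sign/= expr0 mul1r -/gap_sign.
rewrite addrAC -big_split/= big1 ?add0r// => l _.
have ln := ltn_ord l.
rewrite (_ : n.+3 - l = (n.+1 - l).+2)%N; last by lia.
by rewrite -!/(gap_sign _) gap_signSS mulNr addNr.
Qed.

(** The function g_j itself, for |t| < 1. *)
Definition chain_fun j t : R := limn (pseries (chain_coef j) t).

Lemma chain_coef_cvg j : cvg_in_unit_disk (chain_coef j).
Proof. by apply: (@cvg_in_unit_disk_bounded _ _ 1) => n; exact: norm_chain_coef. Qed.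

Lemma chain_fun0 j : chain_fun j 0 = 0.
Proof.
apply: cvg_lim => //; apply: cvg_near_cst; near=> n.
rewrite /pseries /series/= big1// => -[|i] _; rewrite ?chain_coef0 ?mul0r//.
by rewrite exprS mul0r mulr0.
Unshelve. all: by end_near. Qed.

Lemma is_derive_chain_fun0 t : `|t| < 1 ->
  is_derive t 1 (chain_fun 0) (1 - t ^+ 2)^-1.
Proof.
move=> t1; apply: is_derive_eq (is_derive_pseries (@chain_coef_cvg 0) t1) _.
have dcvg := cvg_in_unit_disk_diffs (@chain_coef_cvg 0) t1.
have dE n : pseries_diffs (chain_coef 0) n = (~~ odd n)%:R.
  by rewrite /pseries_diffs/= mulrC divfK.
have := @pseries_mul_quadratic _ (pseries_diffs (chain_coef 0))
  (fun n => (n == 0%N)%:R) (-1) t dcvg.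
rewrite !dE/= => /(_ erefl erefl) h.
have {}h := h (fun n => ltac:(by rewrite !dE /= negbK mulN1r subrr)).
have t2 : 1 - t ^+ 2 != 0.
  by rewrite subr_eq0 eq_sym -real_normK ?num_real// lt_eqF// expr_lt1.
apply: (mulIf t2); rewrite mulVf// -[X in _ * (1 - X)]mul1r -mulNr.
have /cvg_lim <- // := h; apply: cvg_lim => //; apply: cvg_near_cst.
near=> n; rewrite /pseries /series/=.
have n0 : (0 < n)%N by near: n; exact: nbhs_infty_gt.
rewrite -(prednK n0) big_nat_recl//= expr0 mulr1 big1 ?addr0// => i _.
by rewrite mul0r.
Unshelve. all: by end_near. Qed.

Lemma is_derive_chain_funS j t : `|t| < 1 ->
  is_derive t 1 (chain_fun j.+1) (chain_fun j t / (1 + t ^+ 2)).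
Proof.
move=> t1; apply: is_derive_eq (is_derive_pseries (@chain_coef_cvg j.+1) t1) _.
have dcvg := cvg_in_unit_disk_diffs (@chain_coef_cvg j.+1) t1.
have d0 : pseries_diffs (chain_coef j.+1) 0 = chain_coef j 0.
  by rewrite chain_coef_diffs big_ord1 chain_coef0 mulr0.
have d1 : pseries_diffs (chain_coef j.+1) 1 = chain_coef j 1.
  rewrite chain_coef_diffs big_ord_recr big_ord1/= chain_coef0 mulr0 add0r.
  by rewrite /gap_sign/= expr0 mul1r.
have /cvg_lim h := @pseries_mul_quadratic _ _ _ 1 t dcvg d0 d1 (@chain_coef_rec j).
by rewrite /chain_fun h// mul1r mulfK// gt_eqF// ltr_pwDl// sqr_ge0.
Qed.

(** The iterated antiderivatives of 1 / cos that vanish at 0. The substitution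
    t = tan (x / 2) turns dt / (1 + t^2) into dx / 2, whence the power of 2. *)
Definition sec_int j x : R := 2 ^+ j.+1 * chain_fun j (tan (x / 2)).

Lemma sec_int0 j : sec_int j 0 = 0.
Proof. by rewrite /sec_int mul0r tan0 chain_fun0 mulr0. Qed.

Lemma cos_half_gt0 x : 0 <= x < pi / 2 -> 0 < cos (x / 2).
Proof. by move=> xp; have /andP[xl xr] := xp; apply: cos_gt0_pihalf; lra. Qed.

Lemma norm_tan_half_lt1 x : 0 <= x < pi / 2 -> `|tan (x / 2)| < 1.
Proof.
move=> xp; have /andP[xl xr] := xp; have p := pi_gt0 R.
have lt1 : tan (x / 2) < 1.
  by rewrite -[ltRHS]tan_piquarter ltr_tan ?in_itv/=; lra.
have ge0 : 0 <= tan (x / 2).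
  have [->|nx] := eqVneq x 0; first by rewrite mul0r tan0.
  by rewrite ltW// -[ltLHS]tan0 ltr_tan ?in_itv/=; lra.
by rewrite ger0_norm.
Qed.

Lemma is_derive_tan_half x : 0 <= x < pi / 2 ->
  is_derive x 1 (fun y => tan (y / 2)) ((1 + tan (x / 2) ^+ 2) / 2).
Proof.
move=> xp; have /andP[xl xr] := xp; have c0 : cos (x / 2) != 0 by rewrite gt_eqF// cos_half_gt0.
have dh : is_derive x 1 (fun y : R => y / 2) (2^-1).
  have := is_derive_affine 2^-1 0 x; congr is_derive.
  by apply/funext => y; rewrite addr0 mulrC.
have /is_derive_eq := is_derive_chain (f := tan) (g := fun y => y / 2)
  (is_derive_tan c0) dh.
by apply; rewrite cos2_tan2.
Qed.

Lemma is_derive_sec_int0 x : 0 <= x < pi / 2 ->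
  is_derive x 1 (sec_int 0) (cos x)^-1.
Proof.
move=> xp; have /andP[xl xr] := xp; have t1 := norm_tan_half_lt1 xp.
have c0 : cos (x / 2) != 0 by rewrite gt_eqF// cos_half_gt0.
have /is_derive_eq := is_derive_scal (2 ^+ 1) (is_derive_chain
  (g := fun y => tan (y / 2)) (is_derive_chain_fun0 t1) (is_derive_tan_half xp)).
apply.
have -> : cos x = cos (x / 2) ^+ 2 *+ 2 - 1.
  by rewrite -cos_mulr2n mulr2n; congr cos; field.
rewrite expr1 mulrCA [2 * _]mulrC divfK ?pnatr_eq0// -cos2_tan2// /tan.
have := cos2Dsin2 (x / 2); set c := cos _ in c0 *; set s := sin _ => e.
have cx : 0 < c ^+ 2 *+ 2 - 1.
  have -> : c ^+ 2 *+ 2 - 1 = cos x by rewrite -cos_mulr2n mulr2n; congr cos; field.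
  by apply: cos_gt0_pihalf; lra.
have -> : 1 - (s / c) ^+ 2 = (c ^+ 2 *+ 2 - 1) / c ^+ 2.
  have -> : (s / c) ^+ 2 = (1 - c ^+ 2) / c ^+ 2 by rewrite -e expr_div_n addrC addKr.
  by field.
by rewrite invf_div mulrAC mulfV ?expf_neq0// mul1r.
Qed.

Lemma is_derive_sec_intS j x : 0 <= x < pi / 2 ->
  is_derive x 1 (sec_int j.+1) (sec_int j x).
Proof.
move=> xp; have /andP[xl xr] := xp; have t1 := norm_tan_half_lt1 xp.
have /is_derive_eq := is_derive_scal (2 ^+ j.+2) (is_derive_chain
  (g := fun y => tan (y / 2)) (is_derive_chain_funS j t1) (is_derive_tan_half xp)).
apply.
have n0 : 1 + tan (x / 2) ^+ 2 != 0 by rewrite gt_eqF// ltr_pwDl// sqr_ge0.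
by rewrite /sec_int exprS; field.
Qed.

(** Dividing the n-th coefficient by n amounts to integrating against dt / t,
    that is, against dx / sin x for t = tan (x / 2). *)
Definition dlog_coef j n : R := chain_coef j n / n%:R.

Lemma dlog_coef_cvg j : cvg_in_unit_disk (dlog_coef j).
Proof.
apply: (@cvg_in_unit_disk_bounded _ _ 1) => -[|n].
  by rewrite /dlog_coef chain_coef0 mul0r normr0.
rewrite /dlog_coef normrM normfV [`|n.+1%:R|]ger0_norm// ler_pdivrMr// mul1r.
by rewrite (le_trans (norm_chain_coef j _))// ler1n.
Qed.

(** The integral of sec_int j / sin over [0, x]. *)
Definition sec_sin_int j x : R :=
  2 ^+ j.+1 * limn (pseries (dlog_coef j) (tan (x / 2))).

Lemma is_derive_sec_sin_int j x : 0 < x < pi / 2 ->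
  is_derive x 1 (sec_sin_int j) (sec_int j x / sin x).
Proof.
move=> xp; have /andP[xl xr] := xp; have xp0 : 0 <= x < pi / 2 by rewrite (ltW xl).
have t1 := norm_tan_half_lt1 xp0; have c0 := cos_half_gt0 xp0.
have s0 : 0 < sin (x / 2) by apply: sin_gt0_pihalf; lra.
have /is_derive_eq := is_derive_scal (2 ^+ j.+1) (is_derive_chain
  (g := fun y => tan (y / 2)) (is_derive_pseries (@dlog_coef_cvg j) t1)
  (is_derive_tan_half xp0)).
apply.
have dcvg := cvg_in_unit_disk_diffs (@dlog_coef_cvg j) t1.
set t := tan (x / 2).
have h : chain_fun j t = t * limn (pseries (pseries_diffs (dlog_coef j)) t).
  apply: cvg_lim => //; rewrite -cvg_shiftS.
  have -> : [sequence pseries (chain_coef j) t n.+1]_n =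
      (fun n => t * pseries (pseries_diffs (dlog_coef j)) t n).
    apply/funext => n; rewrite /pseries /series/= big_nat_recl// chain_coef0.
    rewrite mul0r add0r mulr_sumr; apply: eq_bigr => i _.
    by rewrite /pseries_diffs /dlog_coef [_.+1%:R * _]mulrC divfK// exprS; ring.
  exact: cvgMl_tmp.
rewrite /sec_int -/t h.
have -> : sin x = (cos (x / 2) * sin (x / 2)) *+ 2.
  by rewrite -sin_mulr2n mulr2n; congr sin; field.
rewrite -cos2_tan2 ?gt_eqF// {2}/t /tan.
by field; rewrite !gt_eqF.
Qed.

Lemma sec_sin_int0 j : sec_sin_int j 0 = 0.
Proof.
rewrite /sec_sin_int mul0r tan0 (_ : limn _ = 0) ?mulr0//.
apply: cvg_lim => //; apply: cvg_near_cst; near=> n.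
rewrite /pseries /series/= big1// => -[|i] _.
  by rewrite /dlog_coef chain_coef0 !mul0r.
by rewrite exprS mul0r mulr0.
Unshelve. all: by end_near. Qed.

Lemma continuous_sec_sin_int j x : 0 <= x < pi / 2 ->
  {for x, continuous (sec_sin_int j)}.
Proof.
move=> xp; exact: is_derive_continuous (is_derive_scal (2 ^+ j.+1) (is_derive_chain
  (g := fun y => tan (y / 2)) (is_derive_pseries (@dlog_coef_cvg j)
  (norm_tan_half_lt1 xp)) (is_derive_tan_half xp))).
Qed.

End IteratedIntegrals.

(** * Fourier sums *)

Section FourierSums.
Variable R : realType.
Implicit Types (i j k n N M : nat) (x y phi : R) (c : nat -> R).

(** The polynomial whose value and successive derivatives at 0 are
    c j, c (j - 1), ..., c 0. *)
Definition taylor c j x : R := \sum_(i < j.+1) c (j - i)%N * (x ^+ i / i`!%:R).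

Lemma taylorS c j x :
  taylor c j.+1 x = taylor (c \o succn) j x + c 0%N * (x ^+ j.+1 / j.+1`!%:R).
Proof.
rewrite /taylor big_ord_recr/= subnn; congr (_ + _).
by apply: eq_bigr => i _; rewrite subSn// -ltnS.
Qed.

Lemma taylor_at0 c j : taylor c j 0 = c j.
Proof.
rewrite /taylor big_ord_recl/= subn0 expr0 fact0 divr1 mulr1 big1 ?addr0// => i _.
by rewrite exprS !mul0r mulr0.
Qed.

Lemma taylor_zero j x : taylor (fun=> 0) j x = 0.
Proof. by rewrite /taylor big1// => i _; rewrite mul0r. Qed.

Lemma eq_taylor c c' j x : (forall i, (i <= j)%N -> c i = c' i) ->
  taylor c j x = taylor c' j x.
Proof. by move=> cc; apply: eq_bigr => i _; rewrite cc// leq_subr. Qed.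

Lemma is_derive_power k x :
  is_derive x 1 (fun y : R => y ^+ k.+1) (k.+1%:R * x ^+ k).
Proof.
elim: k => [|k IH].
  by have := is_derive_id x (1 : R); rewrite expr0 mulr1; congr is_derive.
rewrite [X in is_derive _ _ X](_ : _ = fun y : R => y ^+ k.+1 * y); last first.
  by apply/funext => y; rewrite exprSr.
apply: is_derive_eq (is_derive_mul IH (is_derive_id x 1)) _.
by rewrite -[k.+2%:R]natr1 !exprS; ring.
Qed.

Lemma is_derive_divided_power k x :
  is_derive x 1 (fun y : R => y ^+ k.+1 / k.+1`!%:R) (x ^+ k / k`!%:R).
Proof.
have /is_derive_eq := is_derive_mul (is_derive_power k x)
  (is_derive_const (k.+1`!%:R^-1) x).
apply; rewrite mulr0 addr0 /= factS natrM.
by rewrite invfM mulrACA mulfV ?mul1r// pnatr_eq0.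
Qed.

(** The sum over i of u_(k-i) (y) (a - y)^i / i! has a telescoping derivative
    if each u_j is an antiderivative of its predecessor. *)
Lemma is_derive_taylor_chain (u : nat -> R -> R) (a d x : R) k :
  (forall j, is_derive x 1 (u j.+1) (u j x)) -> is_derive x 1 (u 0%N) d ->
  is_derive x 1 (fun y => taylor (u ^~ y) k (a - y)) (d * ((a - x) ^+ k / k`!%:R)).
Proof.
elim: k u d => [|k IH] u d uS u0.
  rewrite expr0 fact0 divr1 mulr1.
  rewrite [X in is_derive _ _ X](_ : _ = u 0%N)//.
  by apply/funext => y; rewrite /taylor big_ord1 expr0 fact0 divr1 mulr1.
rewrite [X in is_derive _ _ X](_ : _ = fun y => taylor ((u \o succn) ^~ y) k (a - y)
    + u 0%N y * ((a - y) ^+ k.+1 / k.+1`!%:R)); last first.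
  by apply/funext => y; rewrite taylorS.
have dB : is_derive x 1 (fun y : R => a - y) (-1).
  have := is_derive_affine (-1) a x; congr is_derive.
  by apply/funext => y; rewrite mulN1r addrC.
have dP := is_derive_chain (g := fun y => a - y)
  (is_derive_divided_power k (a - x)) dB.
have := is_derive_add (IH (u \o succn) _ (fun j => uS j.+1) (uS 0%N))
  (is_derive_mul u0 dP).
by move=> /is_derive_eq; apply; ring.
Qed.

Lemma is_derive_taylor c j x : is_derive x 1 (taylor c j.+1) (taylor c j x).
Proof.
rewrite [X in is_derive _ _ X](_ : _ = fun y =>
    c j.+1 + \sum_(i < j.+1) c (j - i)%N * (y ^+ i.+1 / i.+1`!%:R)); last first.
  apply/funext => y; rewrite /taylor big_ord_recl/= subn0 expr0 fact0 divr1 mulr1.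
  by congr (_ + _); apply: eq_bigr => i _; rewrite /bump/= add1n subSS.
have dS := is_derive_bigsum (n := j.+1)
  (F := fun i y => c (j - i)%N * (y ^+ i.+1 / i.+1`!%:R))
  (dF := fun i => c (j - i)%N * (x ^+ i / i`!%:R))
  (fun i _ => is_derive_scal _ (is_derive_divided_power i x)).
by have := is_derive_add (is_derive_const (c j.+1) x) dS; rewrite add0r.
Qed.

Lemma cvg_taylor (c : nat -> nat -> R) (l : nat -> R) j x :
  (forall i, (i <= j)%N -> c N i @[N --> \oo] --> l i) ->
  taylor (c N) j x @[N --> \oo] --> taylor l j x.
Proof.
elim: j c l => [|j IH] c l cl.
  rewrite /taylor big_ord1; under eq_fun do rewrite big_ord1.
  by apply: cvgMr_tmp; exact: cl.
rewrite taylorS; under eq_fun do rewrite taylorS.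
apply: cvgD; last by apply: cvgMr_tmp; exact: cl.
by apply: (IH (fun N => c N \o succn)) => i ij; exact: cl.
Qed.

Lemma norm_taylor_le c j x (b : R) : 0 <= x <= 2 -> 0 <= b ->
  (forall i, (i <= j)%N -> `|c i| <= b) -> `|taylor c j x| <= j.+1%:R * 2 ^+ j * b.
Proof.
move=> /andP[x0 x2] b0 cb; apply: le_trans (ler_norm_sum _ _ _) _.
apply: (@le_trans _ _ (\sum_(i < j.+1) 2 ^+ j * b)); last first.
  by rewrite sumr_const card_ord -[leLHS]mulr_natl mulrA.
apply: ler_sum => i _; rewrite normrM mulrC ler_pM ?cb ?leq_subr//.
have ij : (i <= j)%N by rewrite -ltnS.
rewrite ger0_norm ?divr_ge0 ?exprn_ge0// ler_pdivrMr ?ltr0n ?fact_gt0//.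
apply: (@le_trans _ _ (2 ^+ j)); last by rewrite ler_peMr ?exprn_ge0// ler1n fact_gt0.
apply: (@le_trans _ _ (2 ^+ i)); first by rewrite lerXn2r ?nnegrE.
by rewrite ler_eXn2l// ltr1n.
Qed.

(** The partial sums of the series defining dirichlet_beta. *)
Definition beta_sum N s : R := \sum_(n < N) (-1) ^+ n / n.*2.+1%:R ^+ s.

(** The value at 0 of sin (x + phi - i pi / 2), the antiderivative of order i + 1
    of cos (x + phi). *)
Definition phase phi i : R := sin (phi - i%:R * (pi / 2)).

Lemma phaseS phi i : cos (phi - i.+1%:R * (pi / 2)) = phase phi i.
Proof.
by rewrite /phase -cosBpihalf; congr cos; rewrite -[i.+1%:R]natr1; ring.
Qed.

(** The partial sums of the series obtained from that of the terms
    (-1)^n cos ((2n + 1) x + phi) by j + 1 term by term integrations without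
    constants of integration. In the sense of Abel, the original series sums to
    cos phi / (2 cos x). *)
Definition trig_sum phi j N x : R := \sum_(n < N)
  (-1) ^+ n * sin (n.*2.+1%:R * x + (phi - j%:R * (pi / 2))) / n.*2.+1%:R ^+ j.+1.

(** The partial sums of the original series. *)
Definition trig_kernel phi N x : R :=
  \sum_(n < N) (-1) ^+ n * cos (n.*2.+1%:R * x + phi).

Lemma trig_sum0 phi j N : trig_sum phi j N 0 = phase phi j * beta_sum N j.+1.
Proof.
rewrite /trig_sum /beta_sum mulr_sumr; apply: eq_bigr => n _.
by rewrite mulr0 add0r /phase; ring.
Qed.

Lemma is_derive_sin_affine (a b x : R) :
  is_derive x 1 (fun y => sin (a * y + b)) (cos (a * x + b) * a).
Proof.
exact: (is_derive_chain (f := sin) (g := fun y => a * y + b) (is_derive_sin _)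
  (is_derive_affine a b x)).
Qed.

Lemma is_derive_trig_sum phi j N x :
  is_derive x 1 (trig_sum phi j.+1 N) (trig_sum phi j N x).
Proof.
apply: (is_derive_bigsum (F := fun n y => (-1) ^+ n *
  sin (n.*2.+1%:R * y + (phi - j.+1%:R * (pi / 2))) / n.*2.+1%:R ^+ j.+2)
  (dF := fun n => (-1) ^+ n * sin (n.*2.+1%:R * x + (phi - j%:R * (pi / 2)))
  / n.*2.+1%:R ^+ j.+1)) => n _.
have := is_derive_scal ((-1) ^+ n / n.*2.+1%:R ^+ j.+2)
  (is_derive_sin_affine n.*2.+1%:R (phi - j.+1%:R * (pi / 2)) x).
rewrite [X in is_derive _ _ X _ -> _](_ : _ = fun y : R => (-1) ^+ n *
  sin (n.*2.+1%:R * y + (phi - j.+1%:R * (pi / 2))) / n.*2.+1%:R ^+ j.+2); last first.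
  by apply/funext => y; rewrite mulrAC.
move=> /is_derive_eq; apply.
have -> : cos (n.*2.+1%:R * x + (phi - j.+1%:R * (pi / 2))) =
    sin (n.*2.+1%:R * x + (phi - j%:R * (pi / 2))).
  by rewrite -cosBpihalf; congr cos; rewrite -[j.+1%:R]natr1; ring.
have a0 : n.*2.+1%:R != 0 :> R by rewrite pnatr_eq0.
have b0 : n.*2.+1%:R ^+ j.+1 != 0 :> R by rewrite expf_neq0.
have aux (e s a b : R) : a != 0 -> b != 0 -> e / (a * b) * (s * a) = e * s / b.
  by move=> ? ?; field; apply/andP.
by rewrite [_ ^+ j.+2]exprS aux.
Qed.

Lemma is_derive_trig_sum0 phi N x :
  is_derive x 1 (trig_sum phi 0 N) (trig_kernel phi N x).
Proof.
apply: (is_derive_bigsum (F := fun n y => (-1) ^+ n *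
  sin (n.*2.+1%:R * y + (phi - 0%:R * (pi / 2))) / n.*2.+1%:R ^+ 1)
  (dF := fun n => (-1) ^+ n * cos (n.*2.+1%:R * x + phi))) => n _.
have := is_derive_scal ((-1) ^+ n / n.*2.+1%:R)
  (is_derive_sin_affine n.*2.+1%:R phi x).
rewrite [X in is_derive _ _ X _ -> _](_ : _ = fun y : R => (-1) ^+ n *
  sin (n.*2.+1%:R * y + (phi - 0%:R * (pi / 2))) / n.*2.+1%:R ^+ 1); last first.
  by apply/funext => y; rewrite mulrAC expr1 mul0r subr0.
by move=> /is_derive_eq; apply; field.
Qed.

Lemma trig_kernelE phi N x : 2 * cos x * trig_kernel phi N x =
  cos phi - (-1) ^+ N * cos (N.*2%:R * x + phi).
Proof.
elim: N => [|N IH]; first by rewrite /trig_kernel big_ord0 mulr0 mul0r add0r expr0 mul1r subrr.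
rewrite /trig_kernel big_ord_recr/= mulrDr IH exprS.
have -> : N.*2%:R * x + phi = N.*2.+1%:R * x + phi - x by rewrite -[N.*2.+1%:R]natr1; ring.
have -> : N.+1.*2%:R * x + phi = N.*2.+1%:R * x + phi + x.
  by rewrite doubleS -[N.*2.+2%:R]natr1; ring.
by set y := N.*2.+1%:R * x + phi; rewrite (cosB y x) (cosD y x); ring.
Qed.

(** The Taylor remainder of trig_sum at 0: the iterated antiderivative whose
    successive integrations all start at 0. *)
Definition trig_rem phi j N x : R := trig_sum phi j N x -
  taylor (fun i => phase phi i * beta_sum N i.+1) j x.

Lemma trig_rem_at0 phi j N : trig_rem phi j N 0 = 0.
Proof. by rewrite /trig_rem taylor_at0 trig_sum0 subrr. Qed.

Lemma is_derive_trig_rem phi j N x :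
  is_derive x 1 (trig_rem phi j.+1 N) (trig_rem phi j N x).
Proof. exact: is_derive_sub (is_derive_trig_sum _ _ _ _) (is_derive_taylor _ _ _). Qed.

Lemma is_derive_trig_rem0 phi N x :
  is_derive x 1 (trig_rem phi 0 N) (trig_kernel phi N x).
Proof.
have := is_derive_sub (is_derive_trig_sum0 phi N x)
  (is_derive_const (phase phi 0 * beta_sum N 1) x).
rewrite subr0; congr is_derive; apply/funext => y.
by rewrite /trig_rem /taylor big_ord1 expr0 fact0 divr1 mulr1.
Qed.

(** A bound on e_0 passes to its iterated antiderivatives. *)
Lemma iterated_primitive_le (e : nat -> R -> R) (a b : R) :
  0 <= a <= 2 -> 0 <= b ->
  (forall j y, 0 <= y <= a -> is_derive y 1 (e j.+1) (e j y)) ->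
  (forall j, e j 0 = 0) -> (forall y, 0 <= y <= a -> `|e 0%N y| <= b) ->
  forall j y, 0 <= y <= a -> `|e j y| <= 2 ^+ j * b.
Proof.
move=> /andP[a0 a2] b0 eS e0 eb; elim=> [|j IH] y /andP[y0 ya].
  by rewrite expr0 mul1r eb// y0.
have := @increment_le R (e j.+1) (e j) 0 y (2 ^+ j * b) y0.
rewrite e0 !subr0 => h; apply: le_trans (h _ _) _.
- by move=> z /andP[z0 zy]; apply: eS; rewrite z0 (le_trans zy).
- by move=> z /andP[z0 zy]; apply: IH; rewrite z0 (le_trans zy).
- rewrite exprS -[leRHS]mulrA [leRHS]mulrC ler_wpM2l ?mulr_ge0 ?exprn_ge0//.
  exact: le_trans ya a2.
Qed.

End FourierSums.

(** * Convergence of the Fourier sums *)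

Section FourierConvergence.
Variable R : realType.
Implicit Types (i j k n N M : nat) (x y phi : R).

Lemma cos_anti x y : 0 <= y <= x -> x < pi / 2 -> cos x <= cos y.
Proof.
move=> /andP[y0 yx] xp; have p := pi_gt0 R.
have [->//|nyx] := eqVneq y x.
rewrite ltW// ltr_cos ?in_itv/=.
- by rewrite lt_neqAle nyx.
- by apply/andP; split; lra.
- by apply/andP; split; lra.
Qed.

Lemma is_derive_sec x : cos x != 0 ->
  is_derive x 1 (fun y => (cos y)^-1) (sin x / cos x ^+ 2).
Proof.
move=> c0; apply: is_derive_eq (is_deriveV c0 (is_derive_cos x)) _.
by rewrite /GRing.scale/= mulrNN mulrC.
Qed.

(** Integration by parts against the oscillating factor cos (2 N z + phi) of the
    kernel: e - u v below is what remains after the boundary terms. *)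
Lemma trig_rem0_error phi N x y : (0 < N)%N -> 0 <= x < pi / 2 -> 0 <= y <= x ->
  `|trig_rem phi 0 N y - cos phi / 2 * sec_int 0 y| <= N%:R^-1 * (cos x)^-1 ^+ 2.
Proof.
move=> N0 /andP[x0 xp] /andP[y0 yx].
have N0R : 0 < N%:R :> R by rewrite ltr0n.
have p2 := pihalf_bounds R.
have c0 : 0 < cos x by apply: cos_gt0_pihalf; lra.
have cz z : 0 <= z <= x -> cos x <= cos z by move=> zx; exact: cos_anti.
set s : R := - (-1) ^+ N / 2.
have ns : `|s| = 1 / 2.
  by rewrite /s normrM normrN normrX normrN1 expr1n ger0_norm.
pose u z : R := s / N.*2%:R * sin (N.*2%:R * z + phi).
pose v z : R := (cos z)^-1.
pose e z := trig_rem phi 0 N z - cos phi / 2 * sec_int 0 z.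
have N2 : N.*2%:R = 2 * N%:R :> R by rewrite -mul2n natrM.
have nu z : `|u z| <= (4 * N%:R)^-1.
  rewrite /u N2 normrM [`|s / _|]normrM ns normfV [`|2 * N%:R|]ger0_norm ?mulr_ge0//.
  have -> : (4 * N%:R)^-1 = 1 / 2 / (2 * N%:R) :> R by field; rewrite gt_eqF.
  by rewrite ler_piMr ?sin_max// mulr_ge0// invr_ge0 mulr_ge0.
have vle z : 0 <= z <= x -> 0 < v z <= (cos x)^-1.
  move=> zx; have h := cz _ zx; have cz0 := lt_le_trans c0 h.
  by rewrite /v invr_gt0 cz0 lef_pV2.
have dw z : 0 <= z <= x -> is_derive z 1 (fun z => e z - u z * v z)
    (- (u z * (sin z / cos z ^+ 2))).
  move=> zx; have zp : 0 <= z < pi / 2 by have /andP[? ?] := zx; apply/andP; split; lra.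
  have cz0 := lt_le_trans c0 (cz _ zx).
  have du := is_derive_scal (s / N.*2%:R) (is_derive_sin_affine N.*2%:R phi z).
  have dv := is_derive_sec (lt0r_neq0 cz0).
  have de := is_derive_sub (is_derive_trig_rem0 phi N z)
    (is_derive_scal (cos phi / 2) (is_derive_sec_int0 zp)).
  have := is_derive_sub de (is_derive_mul du dv).
  move=> /is_derive_eq; apply; rewrite -/(u z) opprD addrA -[RHS]add0r; congr (_ - _).
  have -> : trig_kernel phi N z = (cos phi - (-1) ^+ N * cos (N.*2%:R * z + phi)) / (2 * cos z).
    have c2 : 2 * cos z != 0 by rewrite mulf_neq0// gt_eqF.
    by apply: (mulIf c2); rewrite divfK// -trig_kernelE mulrC.
  rewrite N2 /s; move: (cos (_ + _)) ((-1) ^+ N) => C d.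
  by field; rewrite !gt_eqF.
have v01 := vle 0 (introT andP (conj (lexx 0) x0)).
have vy := vle y (introT andP (conj y0 yx)).
have B z : 0 <= z <= x -> `|- (u z * (sin z / cos z ^+ 2))| <=
    (4 * N%:R)^-1 * (cos x)^-1 ^+ 2.
  move=> zx; have /andP[v0 v1] := vle _ zx.
  rewrite normrN normrM ler_pM// normrM -exprVn -/(v z) [`|v z ^+ 2|]ger0_norm ?sqr_ge0//.
  rewrite -[leRHS]mul1r ler_pM ?sin_max ?sqr_ge0//.
  by rewrite lerXn2r ?nnegrE ?(ltW v0) ?(ltW (lt_le_trans v0 v1)).
have h1 z : 0 <= z <= y -> 0 <= z <= x.
  by move=> /andP[z0 zy]; rewrite z0 (le_trans zy).
have := @increment_le R (fun z => e z - u z * v z)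
  (fun z => - (u z * (sin z / cos z ^+ 2))) 0 y _ y0
  (fun z h => dw z (h1 z h)) (fun z h => B z (h1 z h)).
have e0 : e 0 = 0 by rewrite /e trig_rem_at0 sec_int0 mulr0 subrr.
rewrite e0 subr0 -/(e y) => hw.
have cV : 1 <= (cos x)^-1 by rewrite invf_ge1// cos_le1.
set V := (cos x)^-1 in v01 vy hw cV *; set b := (4 * N%:R)^-1 in nu hw.
have b0 : 0 <= b by rewrite invr_ge0 mulr_ge0.
have -> : N%:R^-1 = 4 * b by rewrite /b; field; rewrite gt_eqF.
have bound z : 0 < v z <= V -> `|u z * v z| <= b * V ^+ 2.
  move=> /andP[v0 v1]; rewrite normrM ler_pM ?nu// ger0_norm ?(ltW v0)//.
  by apply: le_trans v1 _; rewrite expr2 ler_peMr// (le_trans _ cV).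
have h2 := bound _ v01; have h3 := bound _ vy.
have -> : e y = (e y - u y * v y - (0 - u 0 * v 0)) + u y * v y - u 0 * v 0 by ring.
apply: le_trans (ler_normB _ _) _.
have := ler_normD (e y - u y * v y - (0 - u 0 * v 0)) (u y * v y).
have : b * V ^+ 2 * y <= b * V ^+ 2 * 2.
  by rewrite ler_wpM2l ?mulr_ge0 ?sqr_ge0//; lra.
by move=> h4 h5; lra.
Qed.

Lemma trig_rem_error phi j N x : (0 < N)%N -> 0 <= x < pi / 2 ->
  `|trig_rem phi j N x - cos phi / 2 * sec_int j x| <=
  2 ^+ j * (cos x)^-1 ^+ 2 * N%:R^-1.
Proof.
move=> N0 xp; have /andP[x0 xp2] := xp; have p2 := pihalf_bounds R.
pose e j y := trig_rem phi j N y - cos phi / 2 * sec_int j y.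
rewrite -[leRHS]mulrA [_^-1 ^+ 2 * _]mulrC.
apply: (@iterated_primitive_le R e x).
- by rewrite x0; lra.
- by rewrite mulr_ge0 ?sqr_ge0// invr_ge0.
- move=> i y /andP[y0 yx]; apply: is_derive_sub (is_derive_trig_rem _ _ _ _) _.
  by apply: is_derive_scal; apply: is_derive_sec_intS; rewrite y0 (le_lt_trans yx).
- by move=> i; rewrite /e trig_rem_at0 sec_int0 mulr0 subrr.
- by move=> y yx; apply: trig_rem0_error.
- by rewrite x0 lexx.
Qed.

Lemma cvg_inv_nat (a : R) : (a * N%:R^-1) @[N --> \oo] --> (0 : R).
Proof.
rewrite -cvg_shiftS; suff : (a * harmonic N) @[N --> \oo] --> a * 0 by rewrite mulr0.
by apply: cvgMl_tmp; exact: cvg_harmonic.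
Qed.

Lemma cvg_of_dist_inv (u : nat -> R) (l a : R) :
  (forall N, (0 < N)%N -> `|u N - l| <= a * N%:R^-1) -> u N @[N --> \oo] --> l.
Proof.
move=> ul; apply/cvgrPdist_le => e e0.
have /cvgrPdist_le/(_ _ e0) := cvg_inv_nat a; apply: filter_app.
near=> N; have N0 : (0 < N)%N by near: N; exact: nbhs_infty_gt.
rewrite sub0r normrN => h; rewrite distrC; apply: le_trans (ul N N0) _.
exact: le_trans (ler_norm _) h.
Unshelve. all: by end_near. Qed.

(** Away from pi / 2 the Fourier sums converge to the iterated antiderivatives of
    cos phi / (2 cos x). *)
Lemma cvg_trig_rem phi j x : 0 <= x < pi / 2 ->
  trig_rem phi j N x @[N --> \oo] --> cos phi / 2 * sec_int j x.
Proof.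
by move=> xp; apply: cvg_of_dist_inv => N N0; exact: trig_rem_error.
Qed.

Lemma cvg_beta_sum s : (0 < s)%N ->
  beta_sum R N s @[N --> \oo] --> dirichlet_beta R s.
Proof.
move=> s0; have := @dirichlet_beta_is_cvg R s s0.
rewrite /dirichlet_beta; set f := series _.
have -> : (fun N => beta_sum R N s) = f; last by [].
by apply/funext => N; rewrite /beta_sum /f /series/= big_mkord.
Qed.

Lemma tail_inv_odd_sqr N M : (N <= M)%N ->
  \sum_(N <= n < M) (n.*2.+1%:R ^+ 2)^-1 <= 2 / N.+1%:R :> R.
Proof.
move=> NM; apply: (@le_trans _ _ (\sum_(N <= n < M) - (2 / n.+2%:R - 2 / n.+1%:R))).
  rewrite !big_nat; apply: ler_sum => n _.
  have -> : - (2 / n.+2%:R - 2 / n.+1%:R) = 2 / (n.+1%:R * n.+2%:R) :> R.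
    have aux (a : R) : a != 0 -> a + 1 != 0 ->
        - (2 / (a + 1) - 2 / a) = 2 / (a * (a + 1)).
      by move=> a0 a1; field; rewrite ?a0 ?a1.
    by rewrite -[n.+2%:R]natr1 aux// natr1 pnatr_eq0.
  rewrite -[_^-1]mul1r ler_pdivrMr ?exprn_gt0// mulrAC ler_pdivlMr ?mulr_gt0// mul1r.
  by rewrite -!natrX -!natrM ler_nat; nia.
rewrite sumrN telescope_sumr// opprB lerBlDr lerDl.
by rewrite divr_ge0.
Qed.

Lemma norm_sum_diff_le (f : nat -> R) N M : (N <= M)%N ->
  (forall n, `|f n| <= (n.*2.+1%:R ^+ 2)^-1) ->
  `|\sum_(n < M) f n - \sum_(n < N) f n| <= 2 / N.+1%:R.
Proof.
move=> NM fb; rewrite -!(big_mkord xpredT) (big_cat_nat (leq0n _) NM)/=.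
rewrite addrAC subrr add0r; apply: le_trans (tail_inv_odd_sqr NM).
by apply: le_trans (ler_norm_sum _ _ _) _; apply: ler_sum => n _.
Qed.

Lemma inv_odd_pow_le n j : (n.*2.+1%:R ^+ j.+2)^-1 <= (n.*2.+1%:R ^+ 2)^-1 :> R.
Proof.
rewrite lef_pV2 ?posrE ?exprn_gt0//; apply: ler_weXn2l; first by rewrite ler1n.
by [].
Qed.

Lemma trig_sum_diff_le phi j N M x : (N <= M)%N ->
  `|trig_sum phi j.+1 M x - trig_sum phi j.+1 N x| <= 2 / N.+1%:R.
Proof.
move=> NM; apply: (norm_sum_diff_le (f := fun n => (-1) ^+ n *
  sin (n.*2.+1%:R * x + (phi - j.+1%:R * (pi / 2))) / n.*2.+1%:R ^+ j.+2)) => // n.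
apply: le_trans (inv_odd_pow_le n j).
rewrite !normrM normrX normrN1 expr1n mul1r [`|_^-1|]ger0_norm ?invr_ge0 ?exprn_ge0//.
by rewrite ler_piMl ?sin_max// invr_ge0 exprn_ge0.
Qed.

Lemma beta_sum_diff_le j N M : (N <= M)%N ->
  `|beta_sum R M j.+2 - beta_sum R N j.+2| <= 2 / N.+1%:R.
Proof.
move=> NM; apply: (norm_sum_diff_le (f := fun n => (-1) ^+ n / n.*2.+1%:R ^+ j.+2)) => // n.
apply: le_trans (inv_odd_pow_le n j).
by rewrite normrM normrX normrN1 expr1n mul1r ger0_norm ?invr_ge0 ?exprn_ge0.
Qed.

Lemma taylorB (c c' : nat -> R) j x :
  taylor c j x - taylor c' j x = taylor (fun i => c i - c' i) j x.
Proof. by rewrite /taylor -sumrB; apply: eq_bigr => i _; ring. Qed.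

Lemma phase0 : phase (0 : R) 0 = 0.
Proof. by rewrite /phase mul0r subrr sin0. Qed.

Lemma norm_phase phi i : `|phase phi i| <= 1.
Proof. exact: sin_max. Qed.

(** Here phi = 0, so that the conditionally convergent series for beta 1 has
    coefficient 0 and only absolutely convergent series are left: the estimate is
    uniform in x. *)
Lemma trig_rem_diff_le j N M x : (N <= M)%N -> 0 <= x <= pi / 2 ->
  `|trig_rem 0 j.+1 M x - trig_rem 0 j.+1 N x| <=
  (1 + j.+2%:R * 2 ^+ j.+1) * (2 / N.+1%:R).
Proof.
move=> NM /andP[x0 xp]; have p2 := pihalf_bounds R.
have subrACA (a b c d : R) : a - b - (c - d) = (a - c) - (b - d) by ring.
rewrite /trig_rem subrACA taylorB mulrDl mul1r.
apply: le_trans (ler_normB _ _) _; apply: lerD; first exact: trig_sum_diff_le.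
apply: norm_taylor_le; first by rewrite x0; lra.
- by rewrite divr_ge0.
- case=> [|i] _; first by rewrite phase0 !mul0r subrr normr0 divr_ge0.
  rewrite -mulrBr normrM -[leRHS]mul1r ler_pM ?norm_phase//.
  exact: beta_sum_diff_le.
Qed.

(** The error made by a partial sum is O(x / N) uniformly up to pi / 2. *)
Lemma sec_int_trig_rem_le j N x : 0 <= x < pi / 2 ->
  `|2^-1 * sec_int j.+2 x - trig_rem 0 j.+2 N x| <=
  (1 + j.+2%:R * 2 ^+ j.+1) * (2 / N.+1%:R) * x.
Proof.
move=> xp; have /andP[x0 xp2] := xp.
have := @cvg_trig_rem 0 j.+2 x xp; rewrite cos0 mul1r => h.
have {}h : `|trig_rem 0 j.+2 M x - trig_rem 0 j.+2 N x| @[M --> \oo] -->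
    `|2^-1 * sec_int j.+2 x - trig_rem 0 j.+2 N x|.
  by apply: cvg_norm; apply: cvgB => //; exact: cvg_cst.
rewrite -(cvg_lim _ h)//; apply: limr_le; first exact: cvgP h.
near=> M; have NM : (N <= M)%N by near: M; exact: nbhs_infty_ge.
have := @increment_le R (fun y => trig_rem 0 j.+2 M y - trig_rem 0 j.+2 N y)
  (fun y => trig_rem 0 j.+1 M y - trig_rem 0 j.+1 N y) 0 x _ x0.
rewrite !trig_rem_at0 !subr0; apply.
  by move=> y _; exact: is_derive_sub (is_derive_trig_rem _ _ _ _) (is_derive_trig_rem _ _ _ _).
move=> y /andP[y0 yx]; apply: trig_rem_diff_le => //.
by rewrite y0 (le_trans yx)// ltW.
Unshelve. all: by end_near. Qed.

End FourierConvergence.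

(** * Values at pi / 2 *)

Section Endpoint.
Variable R : realType.
Implicit Types (i j k n N M m : nat) (x y phi : R).

Notation beta := (dirichlet_beta R).

Lemma cos_odd_pihalf n : cos (n.*2.+1%:R * (pi / 2)) = 0 :> R.
Proof.
elim: n => [|n IH]; first by rewrite mul1r cos_pihalf.
have -> : n.+1.*2.+1%:R * (pi / 2) = n.*2.+1%:R * (pi / 2) + pi :> R.
  by rewrite doubleS -[n.*2.+3%:R]natr1 -[n.*2.+2%:R]natr1; field.
by rewrite cosDpi IH oppr0.
Qed.

Lemma trig_sum_pihalf phi j N : cos (phi - j%:R * (pi / 2)) = 0 ->
  trig_sum phi j N (pi / 2) = 0.
Proof.
move=> c0; rewrite /trig_sum big1// => n _.
by rewrite sinD c0 cos_odd_pihalf mulr0 mul0r addr0 mulr0 mul0r.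
Qed.

Lemma trig_rem_pihalf phi j N : cos (phi - j%:R * (pi / 2)) = 0 ->
  trig_rem phi j N (pi / 2) =
  - taylor (fun i => phase phi i * beta_sum R N i.+1) j (pi / 2).
Proof. by move=> c0; rewrite /trig_rem trig_sum_pihalf// sub0r. Qed.

Lemma cvg_taylor_beta phi j x :
  taylor (fun i => phase phi i * beta_sum R N i.+1) j x @[N --> \oo] -->
  taylor (fun i => phase phi i * beta i.+1) j x.
Proof.
apply: (cvg_taylor (c := fun N i => phase phi i * beta_sum R N i.+1)) => i _.
by apply: cvgMl_tmp; exact: cvg_beta_sum.
Qed.

Lemma norm_beta_sum_le j N : `|beta_sum R N j.+1| <= 2.
Proof.
case: j => [|j].
  pose a n : R := n.*2.+1%:R^-1.
  have a0 n : 0 <= a n by rewrite invr_ge0.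
  have ad n : a n.+1 <= a n.
    by rewrite lef_pV2 ?posrE// ler_nat ltnS leq_double.
  have := @alternating_sum_bound R a N a0 ad 0%N; rewrite add0n big_mkord.
  have -> : \sum_(i < N) (-1) ^+ (i - 0) * a i = beta_sum R N 1.
    by apply: eq_bigr => i _; rewrite subn0 expr1.
  have -> : a 0%N = 1 by rewrite /a invr1.
  by move=> /andP[h1 h2]; rewrite ger0_norm; lra.
have := @beta_sum_diff_le R j 0 N (leq0n N).
by rewrite [beta_sum R 0 _]/beta_sum big_ord0 subr0 divr1.
Qed.

Lemma norm_trig_rem_le phi j N x : 0 <= x <= pi / 2 ->
  `|trig_rem phi j.+1 N x| <= 2 + j.+2%:R * 2 ^+ j.+1 * 2.
Proof.
move=> /andP[x0 xp]; have p2 := pihalf_bounds R.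
apply: le_trans (ler_normB _ _) _; apply: lerD.
  have := @trig_sum_diff_le R phi j 0 N x (leq0n N).
  by rewrite [trig_sum _ _ 0 _]/trig_sum big_ord0 subr0 divr1.
apply: norm_taylor_le => //; first by rewrite x0; lra.
move=> i _; rewrite normrM -[leRHS]mul1r ler_pM ?norm_phase//.
exact: norm_beta_sum_le.
Qed.

(** For phi = pi / 2 the remainders tend to 0 on [0, pi / 2), and hence at
    pi / 2 too, since they are Lipschitz uniformly in N. *)
Lemma taylor_beta_eq0 j : cos (pi / 2 - j.+2%:R * (pi / 2)) = 0 :> R ->
  taylor (fun i => phase (pi / 2) i * beta i.+1) j.+2 (pi / 2) = 0.
Proof.
move=> c0; have p2 := pihalf_bounds R.
have h : trig_rem (pi / 2) j.+2 N (pi / 2) @[N --> \oo] -->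
    - taylor (fun i => phase (pi / 2) i * beta i.+1) j.+2 (pi / 2).
  under eq_fun do rewrite trig_rem_pihalf//.
  exact: cvgN (@cvg_taylor_beta _ _ _).
apply/eqP; rewrite -oppr_eq0; apply/eqP; rewrite -(cvg_lim _ h)//.
apply: cvg_lim => //; apply/cvgrPdist_le => e e0.
pose C : R := 2 + j.+2%:R * 2 ^+ j.+1 * 2.
have C0 : 0 < C by rewrite ltr_pwDl// !mulr_ge0// exprn_ge0.
(* x is so close to pi / 2 that the Lipschitz bound costs at most e / 2. *)
pose x : R := Num.max 0 (pi / 2 - e / (2 * C)).
have eC : 0 < e / (2 * C) by rewrite divr_gt0// mulr_gt0.
have xp : 0 <= x < pi / 2.
  by rewrite /x le_max lexx/= gt_max; apply/andP; split; lra.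
have xC : C * (pi / 2 - x) <= e / 2.
  rewrite mulrC -ler_pdivlMr// -mulrA -invfM.
  rewrite lerBlDr -lerBlDl /x le_max; apply/orP; right.
  by rewrite lexx.
have e2 : 0 < e / 2 by lra.
have := @cvg_trig_rem R (pi / 2) j.+2 x xp; rewrite cos_pihalf !mul0r.
move=> /cvgrPdist_le/(_ _ e2); apply: filter_app; near=> N.
rewrite !sub0r !normrN => hx.
have := @increment_le R (trig_rem (pi / 2) j.+2 N) (trig_rem (pi / 2) j.+1 N)
  x (pi / 2) C.
have /andP[x0 xp2] := xp.
move=> /(_ (ltW xp2) (fun y _ => is_derive_trig_rem _ _ _ _)) hC.
have {}hC : `|trig_rem (pi / 2) j.+2 N (pi / 2) - trig_rem (pi / 2) j.+2 N x| <=
    C * (pi / 2 - x).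
  apply: hC => y /andP[xy yp]; apply: norm_trig_rem_le.
  by rewrite yp (le_trans x0).
rewrite -[X in `|X|](subrK (trig_rem (pi / 2) j.+2 N x)).
apply: le_trans (ler_normD _ _) _; lra.
Unshelve. all: by end_near. Qed.

Lemma dirichlet_beta1 : beta 1 = pi / 4.
Proof.
have h := @cvg_beta_sum R 1 isT.
rewrite -(cvg_lim _ h)//; apply: cvg_lim => //.
apply: (@cvg_of_dist_inv R _ _ 1) => N N0; rewrite mul1r.
pose f (x : R) := \sum_(n < N) (-1) ^+ n * (x ^+ n.*2.+1 / n.*2.+1%:R) - atan x.
have df x : is_derive x 1 f (\sum_(n < N) (-1) ^+ n * x ^+ n.*2 - (1 + x ^+ 2)^-1).
  apply: is_derive_sub (is_derive1_atan x).
  apply: (is_derive_bigsum (F := fun n y => (-1) ^+ n * (y ^+ n.*2.+1 / n.*2.+1%:R))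
    (dF := fun n => (-1) ^+ n * x ^+ n.*2)) => n _.
  apply: is_derive_scal.
  have /is_derive_eq := is_derive_mul (is_derive_power n.*2 x)
    (is_derive_const (n.*2.+1%:R^-1 : R) x).
  by apply; rewrite mulr0 addr0 mulrAC mulfV// mul1r.
have dE x : \sum_(n < N) (-1) ^+ n * x ^+ n.*2 - (1 + x ^+ 2)^-1 =
    - (-1) ^+ N * x ^+ N.*2 / (1 + x ^+ 2).
  have n0 : 1 + x ^+ 2 != 0 by rewrite gt_eqF// ltr_pwDl// sqr_ge0.
  apply: (mulIf n0); rewrite mulrBl mulVf// mulfVK//.
  elim: (N) => [|n IH]; first by rewrite big_ord0 mul0r; ring.
  rewrite big_ord_recr/= mulrDl addrAC IH doubleS !exprS; ring.
pose g (x : R) := x ^+ N.*2.+1 / N.*2.+1%:R.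
have dg x : is_derive x 1 g (x ^+ N.*2).
  have /is_derive_eq := is_derive_mul (is_derive_power N.*2 x)
    (is_derive_const (N.*2.+1%:R^-1 : R) x).
  by apply; rewrite mulr0 addr0 mulrAC mulfV// mul1r.
have dle x : `|- (-1) ^+ N * x ^+ N.*2 / (1 + x ^+ 2)| <= x ^+ N.*2.
  have x1 : 1 <= 1 + x ^+ 2 by rewrite lerDl sqr_ge0.
  have xN : 0 <= x ^+ N.*2 by rewrite -muln2 mulnC exprM exprn_ge0// sqr_ge0.
  rewrite !normrM normrN normrX normrN1 expr1n mul1r ger0_norm// ler_piMr//.
  by rewrite ger0_norm ?invr_ge0 ?(le_trans ler01)// invf_le1// (lt_le_trans ltr01).
(* |f'| <= g', so that both f - g and - f - g are nonincreasing. *)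
have key (s : R) : `|s| = 1 -> s * f 1 - g 1 <= s * f 0 - g 0.
  move=> s1.
  pose k (x : R) := s * f x - g x.
  have dk x : is_derive x 1 k (s * (- (-1) ^+ N * x ^+ N.*2 / (1 + x ^+ 2)) - x ^+ N.*2).
    by apply: is_derive_sub => //; apply: is_derive_scal; rewrite -dE.
  have [||z z01 kz] := @MVT_segment R k _ 0 1 _ (fun x _ => dk x).
  - exact: ler01.
  - by apply: derivable_within_continuous => x _; have [] := dk x.
  rewrite -subr_le0 -/(k 1) -/(k 0) kz subr0 mulr1 subr_le0.
  by apply: le_trans (ler_norm _) _; rewrite normrM s1 mul1r.
have f1 : f 1 = beta_sum R N 1 - pi / 4.
  rewrite /f atan1; congr (_ - _); apply: eq_bigr => n _.
  by rewrite expr1n expr1 mul1r.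
have f0 : f 0 = 0.
  rewrite /f atan0 subr0 big1// => n _.
  by rewrite exprS !mul0r mulr0.
have := key 1 (normr1 _); have := key (-1) (normrN1 _).
have g0 : g 0 = 0 by rewrite /g exprS !mul0r.
have g1 : g 1 = N.*2.+1%:R^-1 by rewrite /g expr1n mul1r.
rewrite f0 f1 g0 g1 !mulr0 !subr0 mul1r mulN1r => h1 h2.
apply: (@le_trans _ _ (N.*2.+1%:R^-1)).
  rewrite ler_norml -[X in _ && X]subr_le0 h2 andbT lerNl.
  by rewrite -subr_le0.
by rewrite lef_pV2 ?posrE ?ltr0n// ler_nat -addnn; lia.
Qed.

End Endpoint.

(** * Integration against 1 / sin *)

Section SineIntegrals.
Variable R : realType.
Implicit Types (i j k n N M m : nat) (x y : R).

Notation beta := (dirichlet_beta R).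

(** The integral of x^k / (2 k! sin x) over [0, pi / 2], for odd k. *)
Definition pow_sin_const k : R :=
  - taylor (fun i => phase 0 i * beta i.+1) k (pi / 2).

(** The integral of y^k / (2 k! sin y) over [0, x], for odd k; repeated
    integration by parts after the substitution y = pi / 2 - z. *)
Definition pow_sin_int k x : R :=
  pow_sin_const k - taylor (fun i => 2^-1 * sec_int i (pi / 2 - x)) k x.

Lemma is_derive_pow_sin_int k x : 0 < x <= pi / 2 ->
  is_derive x 1 (pow_sin_int k) (x ^+ k / k`!%:R / (2 * sin x)).
Proof.
move=> /andP[x0 xp].
have yp : 0 <= pi / 2 - x < pi / 2 by apply/andP; split; lra.
pose r y := taylor (fun i => 2^-1 * sec_int i y) k (pi / 2 - y).
have dr : is_derive (pi / 2 - x) 1 r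
    (2^-1 * (cos (pi / 2 - x))^-1 * ((pi / 2 - (pi / 2 - x)) ^+ k / k`!%:R)).
  apply: (is_derive_taylor_chain (u := fun i y => 2^-1 * sec_int i y)).
  - by move=> j; apply: is_derive_scal; exact: is_derive_sec_intS.
  - by apply: is_derive_scal; exact: is_derive_sec_int0.
have dB : is_derive x 1 (fun y : R => pi / 2 - y) (-1).
  have := is_derive_affine (-1) (pi / 2) x; congr is_derive.
  by apply/funext => y; rewrite mulN1r addrC.
have := is_derive_sub (is_derive_const (pow_sin_const k) x) (is_derive_chain
  (g := fun y => pi / 2 - y) dr dB).
rewrite [X in is_derive _ _ X _ -> _](_ : _ = pow_sin_int k); last first.
  by apply/funext => y; rewrite /r subKr.
move=> /is_derive_eq; apply; rewrite subKr sub0r mulrN1 opprK.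
by rewrite -[pi / 2 - x]opprB cosN cosBpihalf invfM mulrC.
Qed.

(** The kernel may blow up at pi / 2 when N grows, but no faster than 1 / cos. *)
Lemma norm_trig_kernel phi N x : 0 <= cos x -> 2 * cos x * `|trig_kernel phi N x| <= 2.
Proof.
move=> c0; rewrite -{1}(ger0_norm (x := 2 * cos x)) ?mulr_ge0// -normrM trig_kernelE.
apply: le_trans (ler_normB _ _) _.
rewrite normrM normrX normrN1 expr1n mul1r.
by have := cos_max phi; have := cos_max (N.*2%:R * x + phi); lra.
Qed.

(** That pow_sin_int vanishes at 0 rests on a bound, uniform in N, for the
    corresponding Fourier sums. *)
Lemma norm_pow_sin_int k x : cos (0 - k.+1%:R * (pi / 2)) = 0 :> R ->
  0 < x <= pi / 2 -> `|pow_sin_int k.+1 x| <= 2 ^+ k.+1 * x.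
Proof.
move=> c0 /andP[x0 xp]; have p2 := pihalf_bounds R.
pose y := pi / 2 - x.
have yp : 0 <= y < pi / 2 by rewrite /y; apply/andP; split; lra.
pose r N (z : R) := taylor (fun i => trig_rem 0 i N z) k.+1 (pi / 2 - z).
have rpi N : r N (pi / 2) =
    - taylor (fun i => phase 0 i * beta_sum R N i.+1) k.+1 (pi / 2).
  by rewrite /r subrr taylor_at0 trig_rem_pihalf.
have dr N (z : R) : is_derive z 1 (r N)
    (trig_kernel 0 N z * ((pi / 2 - z) ^+ k.+1 / k.+1`!%:R)).
  apply: (is_derive_taylor_chain (u := fun i => trig_rem 0 i N)).
  - by move=> j; exact: is_derive_trig_rem.
  - exact: is_derive_trig_rem0.
have rle N : `|r N (pi / 2) - r N y| <= 2 ^+ k.+1 * x.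
  have -> : x = pi / 2 - y by rewrite /y subKr.
  apply: (@increment_le R (r N) _ y (pi / 2) _ _ (fun z _ => dr N z)).
    by rewrite /y; lra.
  move=> z /andP[yz zp].
  have z0 : 0 <= z by rewrite (le_trans _ yz)//; case/andP: yp.
  have zpi : 0 <= z <= pi / 2 by rewrite z0.
  have cz := cos_ge_half zpi.
  have cz0 : 0 <= cos z by lra.
  have K := norm_trig_kernel 0 N cz0.
  rewrite normrM normf_div [`|k.+1`!%:R|]ger0_norm// normrX [`|pi / 2 - z|]ger0_norm ?subr_ge0//.
  apply: (@le_trans _ _ (`|trig_kernel 0 N z| * (pi / 2 - z) ^+ k.+1)).
    rewrite ler_wpM2l// ler_pdivrMr ?ltr0n ?fact_gt0//.
    by rewrite ler_peMr ?exprn_ge0 ?subr_ge0// ler1n fact_gt0.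
  rewrite !exprS mulrA ler_pM ?exprn_ge0 ?mulr_ge0 ?subr_ge0//.
    apply: le_trans K; rewrite mulrC ler_wpM2r//; lra.
  rewrite lerXn2r ?nnegrE ?subr_ge0//; lra.
have h1 : r N (pi / 2) @[N --> \oo] --> pow_sin_const k.+1.
  under eq_fun do rewrite rpi.
  exact: cvgN (@cvg_taylor_beta _ _ _ _).
have h2 : r N y @[N --> \oo] --> taylor (fun i => 2^-1 * sec_int i y) k.+1 x.
  have -> : x = pi / 2 - y by rewrite /y subKr.
  apply: (cvg_taylor (c := fun N i => trig_rem 0 i N y)) => i _.
  by have := @cvg_trig_rem R 0 i y yp; rewrite cos0 mul1r.
have h3 : `|r N (pi / 2) - r N y| @[N --> \oo] --> `|pow_sin_int k.+1 x|.
  by apply: cvg_norm; exact: cvgB h1 h2.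
rewrite -(cvg_lim _ h3)//; apply: limr_le; first exact: cvgP h3.
by near=> N; exact: rle.
Unshelve. all: by end_near. Qed.

Lemma pow_sin_int_pihalf k : pow_sin_int k (pi / 2) = pow_sin_const k.
Proof.
rewrite /pow_sin_int (@eq_taylor R _ (fun=> 0)) ?taylor_zero ?subr0// => i _.
by rewrite subrr sec_int0 mulr0.
Qed.

(** The integral of sin ((2n + 1) y) / sin y over [0, x]. *)
Definition dirichlet_int n x : R := x + \sum_(l < n) sin (l.+1.*2%:R * x) / l.+1%:R.

Lemma dirichlet_int_pihalf n : dirichlet_int n (pi / 2) = pi / 2.
Proof.
rewrite /dirichlet_int big1 ?addr0// => l _.
have -> : l.+1.*2%:R * (pi / 2) = l.+1%:R * pi :> R.
  by rewrite -mul2n natrM; field.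
rewrite (_ : sin _ = 0) ?mul0r//.
elim: (l.+1) => [|i IH]; first by rewrite mul0r sin0.
by rewrite -[i.+1%:R]natr1 mulrDl mul1r sinDpi IH oppr0.
Qed.

Lemma is_derive_dirichlet_int n x : sin x != 0 ->
  is_derive x 1 (dirichlet_int n) (sin (n.*2.+1%:R * x) / sin x).
Proof.
move=> s0.
have dS := is_derive_bigsum (n := n)
  (F := fun l y => l.+1%:R^-1 * sin (l.+1.*2%:R * y + 0))
  (fun l _ => is_derive_scal _ (is_derive_sin_affine l.+1.*2%:R 0 x)).
have := is_derive_add (is_derive_id x 1) dS.
rewrite [X in is_derive _ _ X _ -> _](_ : _ = dirichlet_int n); last first.
  apply/funext => y; rewrite /dirichlet_int; congr (_ + _).
  by apply: eq_bigr => l _; rewrite addr0 mulrC.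
move=> /is_derive_eq; apply; apply: (mulIf s0); rewrite mulfVK//.
elim: n {dS} => [|n IH]; first by rewrite big_ord0 addr0 !mul1r.
rewrite big_ord_recr/= addrA mulrDl IH addr0.
have -> : n.+1%:R^-1 * (cos (n.+1.*2%:R * x) * n.+1.*2%:R) = 2 * cos (n.+1.*2%:R * x).
  have aux (a c : R) : a != 0 -> a^-1 * (c * (2 * a)) = 2 * c by move=> ?; field.
  by rewrite -mul2n [(2 * n.+1)%:R]natrM aux.
have -> : n.*2.+1%:R * x = n.+1.*2%:R * x - x.
  by rewrite doubleS -[n.*2.+2%:R]natr1; ring.
have -> : n.+1.*2.+1%:R * x = n.+1.*2%:R * x + x.
  by rewrite -[n.+1.*2.+1%:R]natr1; ring.
by set y := n.+1.*2%:R * x; rewrite (sinB y x) (sinD y x); ring.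
Qed.

Lemma norm_dirichlet_int n x : 0 <= x -> `|dirichlet_int n x| <= n.*2.+1%:R * x.
Proof.
move=> x0; elim: n => [|n IH].
  by rewrite /dirichlet_int big_ord0 addr0 ger0_norm// mul1r.
rewrite /dirichlet_int big_ord_recr/= addrA.
apply: le_trans (ler_normD _ _) _.
have -> : n.+1.*2.+1%:R * x = n.*2.+1%:R * x + 2 * x.
  by rewrite doubleS -[n.*2.+3%:R]natr1 -[n.*2.+2%:R]natr1; ring.
apply: lerD => //; rewrite normrM normfV [`|n.+1%:R|]ger0_norm//.
rewrite ler_pdivrMr//; apply: le_trans (norm_sin_nat _ x0) _.
by rewrite -mul2n natrM le_eqVlt; apply/orP; left; apply/eqP; ring.
Qed.

End SineIntegrals.

(** * Evaluation of the limit *)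

Section Evaluation.
Variable R : realType.
Implicit Types (i j k n N M m : nat) (x y : R).

Notation beta := (dirichlet_beta R).

Lemma phase0_even k : phase 0 k.*2 = 0 :> R.
Proof.
rewrite /phase sub0r sinN; apply/eqP; rewrite oppr_eq0; apply/eqP.
elim: k => [|k IH]; first by rewrite mul0r sin0.
have -> : k.+1.*2%:R * (pi / 2) = k.*2%:R * (pi / 2) + pi :> R.
  by rewrite doubleS -[k.*2.+2%:R]natr1 -[k.*2.+1%:R]natr1; field.
by rewrite sinDpi IH oppr0.
Qed.

Lemma cos_phase0_odd k : cos (0 - k.*2.+1%:R * (pi / 2)) = 0 :> R.
Proof. by rewrite sub0r cosN cos_odd_pihalf. Qed.

Lemma sin_sub_phase m x : sin (x + (0 - m.*2%:R * (pi / 2))) = (-1) ^+ m * sin x.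
Proof.
elim: m => [|m IH]; first by rewrite mul0r subr0 addr0 expr0 mul1r.
have -> : x + (0 - m.+1.*2%:R * (pi / 2)) = x + (0 - m.*2%:R * (pi / 2)) - pi.
  by rewrite doubleS -[m.*2.+2%:R]natr1 -[m.*2.+1%:R]natr1; field.
have -> y : sin (y - pi) = - sin y by rewrite sinB cospi sinpi; ring.
by rewrite IH exprS; ring.
Qed.

(** An explicit antiderivative of trig_rem 0 (2m) N / sin vanishing at 0+. *)
Definition trig_rem_sin_int m N x : R :=
  (-1) ^+ m * (\sum_(n < N) (-1) ^+ n / n.*2.+1%:R ^+ m.*2.+1 * dirichlet_int n x) -
  \sum_(i < m.*2.+1) phase 0 (m.*2 - i) * beta_sum R N (m.*2 - i).+1 *
    (2 * pow_sin_int i x).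

Lemma is_derive_trig_rem_sin_int m N x : 0 < x <= pi / 2 ->
  is_derive x 1 (trig_rem_sin_int m N) (trig_rem 0 m.*2 N x / sin x).
Proof.
move=> xp; have s0 := sin_bounds_gt0 xp.
have d1 := is_derive_bigsum (n := N)
  (F := fun n y => (-1) ^+ n / n.*2.+1%:R ^+ m.*2.+1 * dirichlet_int n y)
  (fun n _ => is_derive_scal _ (is_derive_dirichlet_int n (lt0r_neq0 s0))).
have d2 := is_derive_bigsum (n := m.*2.+1)
  (F := fun i y => phase 0 (m.*2 - i) * beta_sum R N (m.*2 - i).+1 *
    (2 * pow_sin_int i y))
  (fun i _ => is_derive_scal _ (is_derive_scal 2 (is_derive_pow_sin_int i xp))).
have := is_derive_sub (is_derive_scal ((-1) ^+ m) d1) d2.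
move=> /is_derive_eq; apply; rewrite /trig_rem mulrBl; congr (_ - _).
  rewrite /trig_sum mulr_sumr mulr_suml; apply: eq_bigr => n _.
  by rewrite sin_sub_phase; ring.
rewrite /taylor mulr_suml; apply: eq_bigr => i _.
rewrite invfM; have aux (a b : R) : 2 * (a * (2^-1 * b)) = a * b by field.
by rewrite aux mulrA mulrA.
Qed.

Lemma norm_bigsum_le n (F : nat -> R -> R) (P : R -> Prop) :
  (forall i, (i < n)%N -> exists c : R, forall x, P x -> `|F i x| <= c * x) ->
  exists c : R, forall x, P x -> `|\sum_(i < n) F i x| <= c * x.
Proof.
elim: n => [|n IH] Fn.
  by exists 0 => x _; rewrite big_ord0 normr0 mul0r.
have [|c hc] := IH; first by move=> i /ltnW; exact: Fn.
have [c' hc'] := Fn n (ltnSn n).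
exists (c + c') => x Px; rewrite big_ord_recr/= mulrDl.
by apply: le_trans (ler_normD _ _) _; rewrite lerD ?hc ?hc'.
Qed.

Lemma norm_trig_rem_sin_int m N : exists c : R, forall x, 0 < x <= pi / 2 ->
  `|trig_rem_sin_int m N x| <= c * x.
Proof.
have [|c1 h1] := @norm_bigsum_le N
  (fun n y => (-1) ^+ n / n.*2.+1%:R ^+ m.*2.+1 * dirichlet_int n y)
  (fun x => 0 < x <= pi / 2).
  move=> n _; exists (`|(-1) ^+ n / n.*2.+1%:R ^+ m.*2.+1| * n.*2.+1%:R) => x /andP[x0 _].
  by rewrite normrM -mulrA ler_wpM2l// norm_dirichlet_int// ltW.
have [|c2 h2] := @norm_bigsum_le m.*2.+1
  (fun i y => phase 0 (m.*2 - i) * beta_sum R N (m.*2 - i).+1 *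
    (2 * pow_sin_int i y)) (fun x => 0 < x <= pi / 2).
  move=> i im; have [io|ie] := boolP (odd i).
    have ei : i = i./2.*2.+1 by rewrite -[LHS]odd_double_half io.
    exists (`|phase 0 (m.*2 - i) * beta_sum R N (m.*2 - i).+1 * 2| * 2 ^+ i) => x xp.
    rewrite mulrA normrM -[leRHS]mulrA ler_wpM2l//.
    by rewrite ei; apply: norm_pow_sin_int => //; exact: cos_phase0_odd.
  exists 0 => x _; have -> : (m.*2 - i = (m - i./2).*2)%N.
    by rewrite -[X in (_ - X)%N]odd_double_half (negbTE ie) add0n doubleB.
  by rewrite phase0_even !mul0r normr0.
exists (c1 + c2) => x xp; apply: le_trans (ler_normB _ _) _.
rewrite mulrDl lerD ?h2// normrM normrX normrN1 expr1n mul1r.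
exact: h1.
Qed.

(** Both sides vanish at 0+ and their derivatives differ by O(1 / N), uniformly
    in x since x / sin x is bounded. *)
Lemma sec_sin_int_approx m N x : 0 < x < pi / 2 ->
  `|2^-1 * sec_sin_int m.*2.+2 x - trig_rem_sin_int m.+1 N x| <=
  (1 + m.*2.+2%:R * 2 ^+ m.*2.+1) * 8 / N.+1%:R.
Proof.
move=> /andP[x0 xp]; have p2 := pihalf_bounds R.
pose D (y : R) := 2^-1 * sec_sin_int m.*2.+2 y - trig_rem_sin_int m.+1 N y.
set C : R := 1 + m.*2.+2%:R * 2 ^+ m.*2.+1.
have C0 : 0 <= C by rewrite addr_ge0// mulr_ge0// exprn_ge0.
have dD y : 0 < y < pi / 2 -> is_derive y 1 D
    (2^-1 * (sec_int m.*2.+2 y / sin y) - trig_rem 0 m.+1.*2 N y / sin y).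
  move=> yp; apply: is_derive_sub.
    by apply: is_derive_scal; exact: is_derive_sec_sin_int.
  apply: is_derive_trig_rem_sin_int.
  by case/andP: yp => -> /ltW.
have step d : 0 < d <= x -> `|D x - D d| <= C * 8 / N.+1%:R.
  move=> /andP[d0 dx].
  have h z : d <= z <= x -> 0 < z < pi / 2.
    by move=> /andP[dz zx]; rewrite (lt_le_trans d0 dz) (le_lt_trans zx xp).
  apply: (@le_trans _ _ (C * 4 / N.+1%:R * (x - d))).
    apply: (@increment_le R D _ d x _ dx (fun z dz => dD z (h z dz))) => z dz.
    have /andP[z0 zp] := h z dz.
    have zp' : 0 <= z < pi / 2 by rewrite (ltW z0).
    have zp'' : 0 <= z <= pi / 2 by rewrite !ltW.
    have sz := sin_ge_half zp''.
    have s0 : 0 < sin z by lra.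
    rewrite mulrA -mulrBl normrM normfV (gtr0_norm s0) ler_pdivrMr//.
    apply: le_trans (sec_int_trig_rem_le m.*2 N zp') _.
    rewrite -/C (_ : C * 4 / N.+1%:R * sin z = C * (2 / N.+1%:R) * (2 * sin z)).
      by rewrite ler_wpM2l ?mulr_ge0//; lra.
    by ring.
  rewrite (_ : C * 8 / N.+1%:R = C * 4 / N.+1%:R * 2); last by ring.
  by rewrite ler_wpM2l ?mulr_ge0//; lra.
have [c hc] := norm_trig_rem_sin_int m.+1 N.
apply/ler_addgt0Pr => e e0.
have e2 : 0 < e / 2 by lra.
have H0 : 2^-1 * sec_sin_int m.*2.+2 y @[y --> (0 : R)] --> 2^-1 * sec_sin_int m.*2.+2 0.
  by apply: cvgMl_tmp; apply: continuous_sec_sin_int; rewrite lexx; lra.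
have {H0} := cvg_at_right_filter H0; rewrite sec_sin_int0 mulr0.
move=> /cvgrPdist_le/(_ _ e2) H0.
have c1 : 0 < `|c| + 1 by rewrite ltr_wpDl.
have e3 : 0 < e / 2 / (`|c| + 1) by rewrite divr_gt0.
near (0 : R)^'+ => d.
have d0 : 0 < d by near: d; exact: nbhs_right_gt.
have dx : d <= x by near: d; exact: nbhs_right_le.
have hd : `|2^-1 * sec_sin_int m.*2.+2 d| <= e / 2.
  have : `|0 - 2^-1 * sec_sin_int m.*2.+2 d| <= e / 2 by near: d.
  by rewrite sub0r normrN.
have de : d <= e / 2 / (`|c| + 1) by near: d; exact: nbhs_right_le.
have hP : `|trig_rem_sin_int m.+1 N d| <= e / 2.
  have dp : 0 < d <= pi / 2 by rewrite d0 (le_trans dx)// ltW.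
  apply: le_trans (hc d dp) _.
  apply: (@le_trans _ _ ((`|c| + 1) * d)).
    rewrite ler_wpM2r ?(ltW d0)//; have := ler_norm c; lra.
  by rewrite mulrC -ler_pdivlMr.
have hD : `|D d| <= e.
  by apply: le_trans (ler_normB _ _) _; lra.
have := step d (introT andP (conj d0 dx)) => hs.
rewrite -/(D x) -[D x](subrK (D d)).
apply: le_trans (ler_normD _ _) _.
by apply: lerD.
Unshelve. all: by end_near. Qed.

Lemma trig_rem_sin_int_pihalf m N : trig_rem_sin_int m N (pi / 2) =
  (-1) ^+ m * (pi / 2) * beta_sum R N m.*2.+1 -
  \sum_(i < m.*2.+1) phase 0 (m.*2 - i) * beta_sum R N (m.*2 - i).+1 *
    (2 * pow_sin_const R i).
Proof.
rewrite /trig_rem_sin_int; congr (_ - _); last first.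
  by apply: eq_bigr => i _; rewrite pow_sin_int_pihalf.
rewrite /beta_sum -[RHS]mulrA; congr (_ * _); rewrite mulr_sumr; apply: eq_bigr => n _.
by rewrite dirichlet_int_pihalf mulrC.
Qed.

Lemma cvg_bigsum n (F : nat -> nat -> R) (l : nat -> R) :
  (forall i, (i < n)%N -> F i N @[N --> \oo] --> l i) ->
  \sum_(i < n) F i N @[N --> \oo] --> \sum_(i < n) l i.
Proof.
elim: n => [|n IH] Fl.
  by rewrite big_ord0; under eq_fun do rewrite big_ord0; exact: cvg_cst.
rewrite big_ord_recr; under eq_fun do rewrite big_ord_recr.
by apply: cvgD; [apply: IH => i /ltnW; exact: Fl|exact: Fl].
Qed.

(** Passage to the limit in sec_sin_int_approx, first x --> pi / 2 and then
    N --> oo. *)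
Lemma dlog_series_eq m (c : R) :
  (forall n, \sum_(0 <= k < n) `|dlog_coef R m.+1.*2 k| <= c) ->
  2 ^+ m.+1.*2 * limn (series (dlog_coef R m.+1.*2)) =
  (-1) ^+ m.+1 * (pi / 2) * beta m.+1.*2.+1 -
  \sum_(i < m.+1.*2.+1) phase 0 (m.+1.*2 - i) * beta (m.+1.*2 - i).+1 *
    (2 * pow_sin_const R i).
Proof.
move=> hc; set L := limn _; have p2 := pihalf_bounds R.
pose C : R := (1 + m.*2.+2%:R * 2 ^+ m.*2.+1) * 8.
have key N : `|2 ^+ m.+1.*2 * L - trig_rem_sin_int m.+1 N (pi / 2)| <= C / N.+1%:R.
  (* The parameter t = tan (x / 2) tends to 1 from the left. *)
  have h1 : 2 ^+ m.+1.*2 * limn (pseries (dlog_coef R m.+1.*2) t) @[t --> (1 : R)^'-]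
      --> 2 ^+ m.+1.*2 * L.
    by apply: cvgMl_tmp; exact: pseries_cvg_at_left1 hc.
  have at1 : 2 * atan 1 = pi / 2 :> R by rewrite atan1; field.
  have h2 : trig_rem_sin_int m.+1 N (2 * atan t) @[t --> (1 : R)^'-] -->
      trig_rem_sin_int m.+1 N (pi / 2).
    apply: cvg_at_left_filter; rewrite -at1.
    have d1 : is_derive (2 * atan 1 : R) 1 (trig_rem_sin_int m.+1 N)
        (trig_rem 0 m.+1.*2 N (pi / 2) / sin (pi / 2)).
      by rewrite at1; apply: is_derive_trig_rem_sin_int; rewrite lexx; lra.
    have d2 := is_derive_scal 2 (is_derive1_atan (1 : R)).
    exact: (is_derive_continuous (is_derive_chain (f := trig_rem_sin_int m.+1 N)
      (g := fun t => 2 * atan t) d1 d2)).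
  have h3 : `|2 ^+ m.+1.*2 * limn (pseries (dlog_coef R m.+1.*2) t) -
      trig_rem_sin_int m.+1 N (2 * atan t)| @[t --> (1 : R)^'-] -->
      `|2 ^+ m.+1.*2 * L - trig_rem_sin_int m.+1 N (pi / 2)|.
    by apply: cvg_norm; exact: cvgB h1 h2.
  rewrite -(cvg_lim _ h3)//; apply: limr_le; first exact: cvgP h3.
  near=> t.
  have t0 : 0 < t by near: t; exact: nbhs_left_gt.
  have t1 : t < 1 by near: t; exact: nbhs_left_lt.
  have a0 : 0 < atan t by rewrite -[ltLHS](atan0 R) lt_atan.
  have a1 : atan t < pi / 4 by rewrite -atan1 lt_atan.
  have xp : 0 < 2 * atan t < pi / 2 by apply/andP; split; lra.
  have := sec_sin_int_approx m N xp; rewrite -/C /sec_sin_int.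
  have -> : 2 * atan t / 2 = atan t by field.
  have aux (a b : R) : 2^-1 * (2 * a * b) = a * b by field.
  by rewrite atanK [2 ^+ m.*2.+3]exprS aux.
have l1 : trig_rem_sin_int m.+1 N (pi / 2) @[N --> \oo] --> 2 ^+ m.+1.*2 * L.
  apply: (cvg_of_dist_inv (a := C)) => N N0; rewrite distrC.
  apply: le_trans (key N) _; rewrite ler_wpM2l//.
    by rewrite mulr_ge0// addr_ge0// mulr_ge0// exprn_ge0.
  by rewrite lef_pV2 ?posrE ?ltr0n// ler_nat.
rewrite -(cvg_lim _ l1)//; apply: cvg_lim => //.
under eq_fun do rewrite trig_rem_sin_int_pihalf.
apply: cvgB; first by apply: cvgMl_tmp; exact: cvg_beta_sum.
apply: (cvg_bigsum (F := fun i N => phase 0 (m.+1.*2 - i) *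
  beta_sum R N (m.+1.*2 - i).+1 * (2 * pow_sin_const R i))
  (l := fun i => phase 0 (m.+1.*2 - i) * beta (m.+1.*2 - i).+1 *
  (2 * pow_sin_const R i))) => i _.
by apply: cvgMr_tmp; apply: cvgMl_tmp; exact: cvg_beta_sum.
Unshelve. all: by end_near. Qed.

End Evaluation.

(** * Nested sums over decreasing indices *)

Section NestedSums.
Variable R : realType.
Implicit Types (w : nat -> nat -> R).

(** The sum, over n_1 > ... > n_k all below a, of the products of the weights
    w (i + 0) n_1, ..., w (i + k - 1) n_k. *)
Fixpoint nested_sum w i k a : R :=
  if k is k'.+1 then \sum_(n < a) w i n * nested_sum w i.+1 k' n else 1.

Definition decreasing k N (f : {ffun 'I_k -> 'I_N}) : bool :=
  [forall i : 'I_k, forall j : 'I_k, (i < j)%N ==> (f j < f i)%N].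

(** Adding a first value to, and removing it from, a finite sequence. *)
Definition ffun_cons k N (p : 'I_N * {ffun 'I_k -> 'I_N}) : {ffun 'I_k.+1 -> 'I_N} :=
  [ffun i => if unlift ord0 i is Some j then p.2 j else p.1].

Definition ffun_uncons k N (f : {ffun 'I_k.+1 -> 'I_N}) :=
  (f ord0, [ffun j => f (lift ord0 j)]).

Lemma ffun_cons0 k N (p : 'I_N * {ffun 'I_k -> 'I_N}) : ffun_cons p ord0 = p.1.
Proof. by rewrite ffunE unlift_none. Qed.

Lemma ffun_consS k N (p : 'I_N * {ffun 'I_k -> 'I_N}) (j : 'I_k) :
  ffun_cons p (lift ord0 j) = p.2 j.
Proof. by rewrite ffunE liftK. Qed.

Lemma ffun_consK k N : cancel (@ffun_cons k N) (@ffun_uncons k N).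
Proof.
move=> [n g]; congr pair; first by rewrite ffun_cons0.
by apply/ffunP => j; rewrite ffunE ffun_consS.
Qed.

Lemma ffun_unconsK k N : cancel (@ffun_uncons k N) (@ffun_cons k N).
Proof.
move=> f; apply/ffunP => i; have [j ->|->] := unliftP ord0 i.
  by rewrite ffun_consS ffunE.
by rewrite ffun_cons0.
Qed.

Lemma forall_ord_split k (P : pred 'I_k.+1) :
  [forall i, P i] = P ord0 && [forall j : 'I_k, P (lift ord0 j)].
Proof.
apply/forallP/andP => [h|[h0 /forallP h] i]; first by split=> //; apply/forallP.
by have [j ->|->] := unliftP ord0 i.
Qed.

Lemma decreasing_cons k N a (n : 'I_N) (g : {ffun 'I_k -> 'I_N}) :
  decreasing (ffun_cons (n, g)) && [forall i, (ffun_cons (n, g) i < a)%N] =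
  (n < a)%N && (decreasing g && [forall j, (g j < n)%N]).
Proof.
rewrite /decreasing !forall_ord_split ffun_cons0/=.
apply/andP/and3P.
  move=> [/andP[/forallP h0 /forallP hS] /andP[na /forallP ga]]; split=> //.
  - apply/forallP => i; apply/forallP => j; apply/implyP => ij.
    have /forallP/(_ (lift ord0 j)) := hS i.
    by rewrite !ffun_consS /= /bump/= !add1n ltnS ij.
  - by apply/forallP => j; have := h0 j; rewrite ffun_consS.
move=> [na /forallP gd /forallP gn]; split; last first.
  by rewrite na; apply/forallP => j; rewrite ffun_consS (ltn_trans (gn j)).
apply/andP; split.
  by apply/forallP => j; rewrite ffun_consS; exact: gn.
apply/forallP => i; apply/forallP => j; apply/implyP.
have [j' ->|->//] := unliftP ord0 j.
rewrite !ffun_consS /= /bump/= !add1n ltnS => ij.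
by have /forallP/(_ j')/implyP := gd i; exact.
Qed.

Lemma sum_decreasing w i k N a : (a <= N)%N ->
  \sum_(f : {ffun 'I_k -> 'I_N} | decreasing f && [forall j, (f j < a)%N])
    \prod_(j < k) w (i + j)%N (f j) = nested_sum w i k a.
Proof.
elim: k i a => [|k IH] i a aN /=.
  rewrite (eq_bigr (fun=> 1)); last by move=> f _; rewrite big_ord0.
  rewrite (eq_bigl predT); last first.
    by move=> f; apply/andP; split; apply/forallP => -[].
  by rewrite sumr_const card_ffun !card_ord expn0.
rewrite (reindex (@ffun_cons k N)); last first.
  by apply: onW_bij; exists (@ffun_uncons k N); [exact: ffun_consK|exact: ffun_unconsK].
rewrite (eq_bigl (fun p : 'I_N * {ffun 'I_k -> 'I_N} => (p.1 < a)%N &&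
    (decreasing p.2 && [forall j, (p.2 j < p.1)%N]))); last first.
  by move=> [n g]; rewrite decreasing_cons.
rewrite -(pair_big_dep (fun n : 'I_N => (n < a)%N)
  (fun n g => decreasing g && [forall j, (g j < n)%N])
  (fun n g => \prod_(j < k.+1) w (i + j)%N (ffun_cons (n, g) j)))/=.
rewrite [RHS](big_ord_widen _ (fun n => w i n * nested_sum w i.+1 k n) aN).
apply: eq_bigr => n _; rewrite -(IH i.+1 n (ltnW (ltn_ord n))) mulr_sumr.
apply: eq_bigr => g _; rewrite big_ord_recl ffun_cons0 addn0; congr (_ * _).
by apply: eq_bigr => j _; rewrite ffun_consS /bump/= addnA addn1.
Qed.

Lemma norm_nested_sum_le w i k a :
  `|nested_sum w i k a| <= nested_sum (fun i n => `|w i n|) i k a.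
Proof.
elim: k i a => [|k IH] i a /=; first by rewrite normr1.
apply: le_trans (ler_norm_sum _ _ _) _; apply: ler_sum => n _.
by rewrite normrM ler_wpM2l.
Qed.

Lemma sum_multT_index m N w :
  (forall i n, (i < (2 * m).+1)%N -> n = 0%N \/ odd n <> ~~ odd i -> w i n = 0) ->
  \sum_(f : {ffun 'I_(2 * m).+1 -> 'I_N} | multT_index f) \prod_(i < (2 * m).+1) w i (f i) =
  nested_sum w 0 (2 * m).+1 N.
Proof.
move=> w0; rewrite -(sum_decreasing w 0 _ (leqnn N)).
rewrite [RHS](bigID (@multT_index m N))/= [X in _ = _ + X]big1 ?addr0.
  apply: eq_bigl => f; rewrite andbC; case E : (multT_index f) => //=.
  have /and3P[fd _ _] := E; apply/esym/andP; split=> //.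
  by apply/forallP => j.
move=> f /andP[/andP[fd _]]; rewrite /multT_index.
rewrite -/(decreasing f) fd/= negb_and => /orP[/forallPn[i]|/forallPn[i]] h.
  have wi : w i (f i) = 0 by apply: w0 => //; left; apply/eqP; rewrite -leqn0 leqNgt.
  by rewrite (bigD1 i)//= add0n wi mul0r.
have wi : w i (f i) = 0 by apply: w0 => //; right; apply/eqP.
by rewrite (bigD1 i)//= add0n wi mul0r.
Qed.

(** The sign attached to an extreme index, which is odd. *)
Definition end_sign n : R := (-1) ^+ n.-1./2.

(** The factor contributed by the index n in position i; indices of the wrong
    parity get weight 0, and so does 0 because 0^-1 = 0. *)
Definition multT_weight m i n : R :=
  (odd n == ~~ odd i)%:R *
  (if i == 0%N then end_sign n / n%:R else if i == (2 * m)%N then end_sign n else 1)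
  / n%:R.

Lemma multT_weight_eq0 m i n : n = 0%N \/ odd n <> ~~ odd i -> multT_weight m i n = 0.
Proof.
by rewrite /multT_weight => -[->|/eqP/negbTE ->]; rewrite ?invr0 ?mulr0 ?mul0r.
Qed.

Lemma multT_term_weight m N (f : {ffun 'I_(2 * m).+1 -> 'I_N}) : (0 < m)%N ->
  multT_index f -> multT_term R f = \prod_(i < (2 * m).+1) multT_weight m i (f i).
Proof.
move=> m0 /and3P[_ _ /forallP fpar].
have max0 : ord_max != ord0 :> 'I_(2 * m).+1 by rewrite -val_eqE/= muln_eq0/= -lt0n.
pose s (i : 'I_(2 * m).+1) : R := if i == ord0 then end_sign (f i) / (f i)%:R
  else if i == ord_max then end_sign (f i) else 1.
rewrite (eq_bigr (fun i => s i * (f i)%:R^-1)); last first.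
  by move=> i _; rewrite /multT_weight fpar mul1r.
rewrite big_split/= prodfV (bigD1 ord0)//= (bigD1 ord_max)//= big1; last first.
  by move=> i /andP[i0 im]; rewrite /s (negbTE i0) (negbTE im).
rewrite /s eqxx (negbTE max0) eqxx mulr1 [X in _ = _ / X](bigD1 ord0)//=.
rewrite /multT_term -!/(end_sign _) expr2 !invfM.
by ring.
Qed.

Lemma chain_coef_parity j n : odd n != ~~ odd j -> chain_coef R j n = 0.
Proof.
elim: j n => [|j IH] n /=; first by case: (odd n) => // _; rewrite mul0r.
rewrite negbK => nj; rewrite big1 ?mulr0// => l _.
have [lj|/IH ->] := eqVneq (odd l) (~~ odd j); last by rewrite mulr0.
rewrite /gap_sign oddB; last exact: ltnW.
by rewrite lj; move: nj; case: (odd n); case: (odd j); rewrite //= mul0r.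
Qed.

(** The signs attached to the two extreme indices are distributed over the
    gaps between consecutive indices. *)
Lemma sum_signed_chain_coef (j n : nat) : odd n = ~~ odd j.+1 ->
  \sum_(l < n) (-1) ^+ (uphalf j + l./2) * chain_coef R j l =
  (-1) ^+ (uphalf j.+1 + n./2) * \sum_(l < n) gap_sign R (n - l) * chain_coef R j l.
Proof.
move=> nj; rewrite mulr_sumr; apply: eq_bigr => l _.
have [lj|lj] := eqVneq (odd l) (~~ odd j); last by rewrite chain_coef_parity// !mulr0.
rewrite mulrA; congr (_ * _).
have ln := ltn_ord l.
have o : odd (n - l) by rewrite oddB ?(ltnW ln)// lj nj/=; case: (odd j).
rewrite /gap_sign o -exprD -signr_odd -[RHS]signr_odd; congr (_ ^+ _); congr nat_of_bool.
have := odd_double_half n; have := odd_double_half l; have := odd_double_half (n - l).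
rewrite uphalf_half o lj nj /=.
case: (odd j) => /= hnl hl hn.
  have -> : n./2 = ((n - l)./2 + l./2)%N by lia.
  by rewrite !oddD/=; case: (odd j./2); case: (odd l./2); case: (odd (n - l)./2).
have -> : n./2 = ((n - l)./2 + l./2).+1 by lia.
by rewrite /= !oddD/= !oddD; case: (odd j./2); case: (odd l./2); case: (odd (n - l)./2).
Qed.

Lemma nested_sum_chain_coef (m j i n : nat) : (0 < i)%N -> (i + j = 2 * m)%N ->
  multT_weight m i n * nested_sum (multT_weight m) i.+1 j n =
  (-1) ^+ (uphalf j + n./2) * chain_coef R j n.
Proof.
elim: j i n => [|j IH] i n i0 ij.
  rewrite /= mulr1 add0n; have ei : i = (2 * m)%N by rewrite -ij addn0.
  rewrite /multT_weight -ei gtn_eqF// eqxx; have -> : odd i = false.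
    by rewrite ei mul2n odd_double.
  rewrite eqb_id /end_sign; case E : (odd n); last by rewrite !mul0r mulr0.
  by rewrite !mul1r -[in n.-1](odd_double_half n) E add1n/= doubleK.
have oij : odd i = odd j.+1.
  by have := congr1 odd ij; rewrite oddD mul2n odd_double/=; case: (odd i); case: (odd j).
have [nj|nj] := eqVneq (odd n) (~~ odd j.+1); last first.
  rewrite (@chain_coef_parity j.+1)// mulr0 multT_weight_eq0 ?mul0r//.
  by right; apply/eqP; rewrite oij.
have -> : multT_weight m i n = n%:R^-1.
  rewrite /multT_weight gtn_eqF//.
  have -> : (i == 2 * m)%N = false.
    by apply/negbTE; rewrite neq_ltn -ij addnS ltnS leq_addr.
  by rewrite oij nj eqxx mulr1 mul1r.
rewrite [nested_sum _ _ _ _]/= [chain_coef _ _ _]/= mulrCA; congr (_ * _).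
rewrite -sum_signed_chain_coef//; apply: eq_bigr => l _.
by rewrite IH// addSnnS.
Qed.

(** The top index carries the extra factor 1 / n. *)
Lemma top_weight (m n : nat) : (0 < m)%N ->
  multT_weight m 0 n * nested_sum (multT_weight m) 1 (2 * m) n =
  (-1) ^+ m * dlog_coef R m.*2 n.
Proof.
move=> m0; have [no|no] := boolP (odd n); last first.
  rewrite multT_weight_eq0 ?mul0r; last by right; rewrite (negbTE no).
  by rewrite /dlog_coef chain_coef_parity ?mul0r ?mulr0// odd_double (negbTE no).
have [p mp] : exists p, m.*2 = p.+1 by exists m.*2.-1; rewrite prednK// double_gt0.
have op : odd n = ~~ odd p.+1 by rewrite -mp odd_double.
rewrite mul2n /dlog_coef mp [nested_sum _ _ _ _]/= [chain_coef _ _ _]/=.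
rewrite (eq_bigr (fun l : 'I_n => (-1) ^+ (uphalf p + l./2) * chain_coef R p l)); last first.
  by move=> l _; rewrite nested_sum_chain_coef// add1n -mp mul2n.
rewrite sum_signed_chain_coef// -mp uphalf_double exprD.
have -> : multT_weight m 0 n = (-1) ^+ n./2 / n%:R / n%:R.
  rewrite /multT_weight no eqxx mul1r /end_sign; congr (_ ^+ _ / _ / _).
  by rewrite -[in n.-1](odd_double_half n) no add1n/= doubleK.
have sq : (-1) ^+ n./2 * (-1) ^+ n./2 = 1 :> R by rewrite -exprD addnn -signr_odd odd_double.
set e := (-1) ^+ n./2 in sq *; set x := n%:R^-1; set S := \sum_(_ < _) _.
transitivity (e * e * ((-1) ^+ m * (x * S * x))); first by ring.
by rewrite sq mul1r.
Qed.

Lemma multT_partialE (m N : nat) : (0 < m)%N ->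
  multT_partial R m N = (-1) ^+ m * \sum_(n < N) dlog_coef R m.*2 n.
Proof.
move=> m0; rewrite /multT_partial.
rewrite (eq_bigr (fun f : {ffun 'I_(2 * m).+1 -> 'I_N} =>
    \prod_(i < (2 * m).+1) multT_weight m i (f i))); last first.
  by move=> f; exact: multT_term_weight.
rewrite sum_multT_index; last by move=> i n _; exact: multT_weight_eq0.
by rewrite mulr_sumr; apply: eq_bigr => n _; exact: top_weight.
Qed.

Lemma dlog_coef_abs_bounded (m : nat) : (0 < m)%N ->
  exists c : R, forall N, \sum_(0 <= n < N) `|dlog_coef R m.*2 n| <= c.
Proof.
move=> m0; have [c hc] := multT_abs_bounded R m; exists c => N.
apply: le_trans (hc N).
rewrite (eq_bigr (fun f : {ffun 'I_(2 * m).+1 -> 'I_N} =>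
    \prod_(i < (2 * m).+1) `|multT_weight m i (f i)|)); last first.
  by move=> f fI; rewrite multT_term_weight// normr_prod.
rewrite (sum_multT_index N (w := fun i n => `|multT_weight m i n|)); last first.
  by move=> i n _ h; rewrite multT_weight_eq0// normr0.
rewrite big_mkord; apply: ler_sum => n _.
have <- : `|(-1) ^+ m * dlog_coef R m.*2 n| = `|dlog_coef R m.*2 n|.
  by rewrite normrM normrX normrN1 expr1n mul1r.
rewrite -top_weight// normrM ler_wpM2l//.
exact: norm_nested_sum_le.
Qed.

Lemma multT_dlog (m : nat) : (0 < m)%N ->
  multT R m = 2 ^+ m.*2.+1 * ((-1) ^+ m * limn (series (dlog_coef R m.*2))).
Proof.
move=> m0; have [c hc] := dlog_coef_abs_bounded m0.
have dcvg : cvgn (series (dlog_coef R m.*2)).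
  apply: normed_cvg; apply: nondecreasing_is_cvgn.
    exact: nondecreasing_series_norm.
  by exists c => _ [n _ <-]; exact: hc.
rewrite /multT mul2n; congr (_ * _); apply: cvg_lim => //.
rewrite (_ : multT_partial R m = fun N => (-1) ^+ m * series (dlog_coef R m.*2) N).
  exact: cvgMl_tmp.
by apply/funext => N; rewrite multT_partialE// /series/= big_mkord.
Qed.

End NestedSums.

(** * The closed formula *)

Section ClosedFormula.
Variable R : realType.

Notation beta := (dirichlet_beta R).

Definition pow_div_fact (k : nat) : R := (pi / 2) ^+ k / k`!%:R.

(** The sum over p + 2k = n of (-1)^k beta (p + 1) (pi / 2)^(2k) / (2k)!,
    written over a = 2k. *)
Definition beta_cos_sum (n : nat) : R :=
  \sum_(a < n.+1 | ~~ odd a) (-1) ^+ a./2 * beta (n - a).+1 * pow_div_fact a.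

Lemma phaseSS (phi : R) i : phase phi i.+2 = - phase phi i.
Proof.
rewrite /phase.
have -> : phi - i.+2%:R * (pi / 2) = phi - i%:R * (pi / 2) - pi.
  by rewrite -[i.+2%:R]natr1 -[i.+1%:R]natr1; field.
by rewrite [LHS]sinB cospi sinpi; ring.
Qed.

Lemma phase_double (phi : R) k i : phase phi (k.*2 + i) = (-1) ^+ k * phase phi i.
Proof.
elim: k => [|k IH]; first by rewrite expr0 mul1r.
by rewrite doubleS !addSn phaseSS IH exprS; ring.
Qed.

Lemma phase0_odd k : phase 0 k.*2.+1 = - (-1) ^+ k :> R.
Proof.
by rewrite -(addn1 k.*2) phase_double /phase sub0r mul1r sinN sin_pihalf mulrN1.
Qed.

Lemma phase_pihalf_even k : phase (pi / 2) k.*2 = (-1) ^+ k :> R.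
Proof. by rewrite -[k.*2]addn0 phase_double /phase mul0r subr0 sin_pihalf mulr1. Qed.

Lemma phase_pihalf_odd k : phase (pi / 2) k.*2.+1 = 0 :> R.
Proof. by rewrite -(addn1 k.*2) phase_double /phase mul1r subrr sin0 mulr0. Qed.

Lemma sum_even_index (F : nat -> R) n N : (n < N)%N ->
  \sum_(a < n.+1 | ~~ odd a) F a = \sum_(k < N | (k.*2 <= n)%N) F k.*2.
Proof.
elim: n => [|n IH] nN.
  rewrite big_mkcond big_ord1/= (bigD1 (Ordinal nN))//= big1 ?addr0// => i.
  by case: i => -[|i] iN.
rewrite big_mkcond big_ord_recr -big_mkcond/= IH ?(ltnW nN)//.
have [no|ne] := boolP (odd n).
  have hN : (n.+1./2 < N)%N by rewrite ltn_half_double -addnn; lia.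
  have n1 : n.+1 = n.+1./2.*2 by rewrite -[LHS]odd_double_half/= no.
  rewrite [RHS](bigD1 (Ordinal hN))/=; last by rewrite -n1.
  rewrite addrC -n1; congr (_ + _); apply: eq_bigl => k.
  rewrite -val_eqE/=; move: n1; move: (n.+1./2) => h n1.
  by apply/idP/andP => [kn|[kn /eqP kh]]; [split; [|apply/eqP]|]; lia.
rewrite addr0; apply: eq_bigl => k.
have := odd_double_half n; rewrite (negbTE ne) => n2.
by apply/idP/idP => kn; lia.
Qed.

Lemma sign_sqr k : (-1) ^+ k * (-1) ^+ k = 1 :> R.
Proof. by rewrite -exprD addnn -signr_odd odd_double. Qed.

Lemma sign_subn k n : (k <= n)%N -> (-1) ^+ (n - k) = (-1) ^+ n * (-1) ^+ k :> R.
Proof. by move=> kn; rewrite -{2}(subnK kn) exprD -mulrA sign_sqr mulr1. Qed.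

Lemma taylor_beta_even n :
  taylor (fun i => phase (pi / 2) i * beta i.+1) n.*2 (pi / 2) =
  (-1) ^+ n * beta_cos_sum n.*2.
Proof.
rewrite /taylor (bigID (fun a : 'I_n.*2.+1 => odd a))/= big1 ?add0r.
  rewrite /beta_cos_sum mulr_sumr; apply: eq_bigr => a ao.
  have a2 : a = a./2.*2 :> nat by rewrite -[LHS]odd_double_half (negbTE ao).
  have an : (a./2 <= n)%N by rewrite -leq_double -a2 -ltnS.
  have -> : (n.*2 - a = (n - a./2).*2)%N by rewrite doubleB -a2.
  rewrite phase_pihalf_even -/(pow_div_fact a) !mulrA; congr (_ * _ * _).
  by rewrite sign_subn.
move=> a ao; have a2 : a = a./2.*2.+1 :> nat by rewrite -[LHS]odd_double_half ao.
have an := ltn_ord a.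
have -> : (n.*2 - a = (n - a./2.+1).*2.+1)%N by lia.
by rewrite phase_pihalf_odd !mul0r.
Qed.

Lemma taylor_beta_odd n :
  taylor (fun i => phase 0 i * beta i.+1) n.*2.+1 (pi / 2) =
  - (-1) ^+ n * beta_cos_sum n.*2.+1.
Proof.
rewrite /taylor (bigID (fun a : 'I_n.*2.+2 => odd a))/= big1 ?add0r.
  rewrite /beta_cos_sum mulr_sumr; apply: eq_bigr => a ao.
  have a2 : a = a./2.*2 :> nat by rewrite -[LHS]odd_double_half (negbTE ao).
  have an := ltn_ord a.
  have -> : (n.*2.+1 - a = (n - a./2).*2.+1)%N by lia.
  rewrite phase0_odd -/(pow_div_fact a) !mulrA; congr (_ * _ * _).
  have an2 : (a./2 <= n)%N by lia.
  by rewrite sign_subn// mulNr.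
move=> a ao; have a2 : a = a./2.*2.+1 :> nat by rewrite -[LHS]odd_double_half ao.
have an := ltn_ord a.
have -> : (n.*2.+1 - a = (n - a./2).*2)%N by lia.
by rewrite phase0_even !mul0r.
Qed.

(** The coefficients of the product of cos (pi z / 2) and the generating series
    of the values beta (2k + 1), which is the constant pi / 4. *)
Lemma beta_cos_sum_even n : beta_cos_sum n.+1.*2 = 0.
Proof.
have /eqP : (-1) ^+ n.+1 * beta_cos_sum n.+1.*2 = 0.
  rewrite -taylor_beta_even doubleS taylor_beta_eq0//.
  by rewrite (phaseS _ n.*2.+1) phase_pihalf_odd.
by rewrite mulf_eq0 signr_eq0 => /eqP.
Qed.

Lemma beta_cos_sum0 : beta_cos_sum 0 = pi / 4.
Proof.
rewrite /beta_cos_sum big_mkcond big_ord1/= expr0 mul1r dirichlet_beta1.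
by rewrite /pow_div_fact expr0 divr1 mulr1.
Qed.

(** The first summand is what the Dirichlet integrals contribute; each odd r
    comes from the monomial of degree 2m - r in the expansion of sec_int. *)
Lemma multT_beta_cos_sum m : multT R m.+1 = pi * beta m.+1.*2.+1 -
  4 * \sum_(r < m.+1.*2.+1 | odd r) beta r.+1 * beta_cos_sum (m.+1.*2 - r).
Proof.
have [c hc] := @dlog_coef_abs_bounded R m.+1 isT.
rewrite multT_dlog// exprS.
have sq := sign_sqr m.+1.
have -> (a b l : R) : 2 * a * (b * l) = 2 * b * (a * l) by ring.
rewrite (dlog_series_eq hc) mulrBr; congr (_ - _).
  set e := (-1) ^+ m.+1 in sq *.
  have -> (b : R) : 2 * e * (e * (pi / 2) * b) = e * e * (pi * b) by field.
  by rewrite sq mul1r.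
rewrite (reindex_inj rev_ord_inj)/= [RHS](_ : _ = \sum_(r < m.+1.*2.+1 | odd r)
    4 * (beta r.+1 * beta_cos_sum (m.+1.*2 - r))); last by rewrite mulr_sumr.
rewrite mulr_sumr [RHS]big_mkcond; apply: eq_bigr => r _.
have rm : (r <= m.+1.*2)%N by rewrite -ltnS.
rewrite subSS subKn//; case: ifPn => ro; last first.
  have -> : r = r./2.*2 :> nat by rewrite -[LHS]odd_double_half (negbTE ro).
  by rewrite phase0_even !mul0r mulr0.
have r2 : r = r./2.*2.+1 :> nat by rewrite -[LHS]odd_double_half ro.
have rm2 : (r./2 <= m)%N by lia.
have -> : (m.+1.*2 - r = (m - r./2).*2.+1)%N by lia.
rewrite /pow_sin_const taylor_beta_odd mulNr opprK.
rewrite [in phase 0 r]r2 phase0_odd.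
have -> : (-1) ^+ m.+1 = - ((-1) ^+ (m - r./2) * (-1) ^+ r./2) :> R.
  by rewrite -exprD subnK// exprS mulN1r.
set u := (-1) ^+ (m - r./2); set v := (-1) ^+ r./2; set B := beta r.+1.
have uu : u * u = 1 := sign_sqr _.
have vv : v * v = 1 := sign_sqr _.
set S := beta_cos_sum _.
transitivity (4 * (B * S) * (u * u) * (v * v)); first by ring.
by rewrite uu vv !mulr1.
Qed.

Lemma triple_sum_beta_cos_sum m r : (r <= 2 * m)%N ->
  \sum_(p < (2 * m).+1) \sum_(k < (2 * m).+1 | (r + p + 2 * k == 2 * m)%N)
    4 * (-1) ^+ (r + k) * beta r.+1 * beta p.+1 *
    ((2 * k)`!%:R^-1 * (pi / 2) ^+ (2 * k)) =
  4 * (-1) ^+ r * beta r.+1 * beta_cos_sum (2 * m - r).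
Proof.
move=> rm; rewrite (exchange_big_dep xpredT)//= /beta_cos_sum mulr_sumr.
rewrite (@sum_even_index (fun a => 4 * (-1) ^+ r * beta r.+1 *
  ((-1) ^+ a./2 * beta (2 * m - r - a).+1 * pow_div_fact a)) _ (2 * m).+1);
  last by rewrite ltnS leq_subr.
rewrite [RHS]big_mkcond; apply: eq_bigr => k _; case: ifPn => h.
  have hp : (2 * m - r - k.*2 < (2 * m).+1)%N by rewrite ltnS; lia.
  rewrite (big_pred1 (Ordinal hp)); last first.
    by move=> p; rewrite /= -val_eqE/=; apply/eqP/eqP; lia.
  by rewrite /= doubleK /pow_div_fact [(2 * k)%N]mul2n exprD; ring.
by apply: big_pred0 => p; apply/negbTE/eqP; move: h; rewrite -ltnNge; lia.
Qed.

Lemma multT_triple_sum m : (0 < m)%N -> multT R m =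
  \sum_(r < (2 * m).+1) \sum_(p < (2 * m).+1)
    \sum_(k < (2 * m).+1 | (r + p + 2 * k == 2 * m)%N)
      4 * (-1) ^+ (r + k) * beta r.+1 * beta p.+1 *
      ((2 * k)`!%:R^-1 * (pi / 2) ^+ (2 * k)).
Proof.
case: m => // m _.
under eq_bigr => r _ do rewrite triple_sum_beta_cos_sum -1?ltnS//.
rewrite multT_beta_cos_sum mul2n [RHS](bigID (fun r : 'I_m.+1.*2.+1 => odd r))/= [RHS]addrC.
congr (_ + _).
  rewrite big_mkcond big_ord_recr -big_mkcond/= odd_double/= subnn.
  rewrite -signr_odd odd_double beta_cos_sum0 big1 ?add0r; last first.
    move=> r ro; have r2 : r = r./2.*2 :> nat by rewrite -[LHS]odd_double_half (negbTE ro).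
    have rm := ltn_ord r.
    have -> : (m.+1.*2 - r = (m - r./2).+1.*2)%N by lia.
    by rewrite beta_cos_sum_even mulr0.
  by rewrite expr0; field.
rewrite mulr_sumr -sumrN; apply: eq_bigr => r ro.
by rewrite -signr_odd ro expr1; ring.
Qed.

(** Membership of pi * beta (2k + 1) follows by induction on k from the
    recurrence beta_cos_sum_even. *)
Section Membership.
Variable M : set R.
Hypothesis Malg : rat_subalgebra M.
Hypothesis Mpi2 : M (pi ^+ 2).
Hypothesis Mbeta : forall k, (0 < k)%N -> M (beta k.*2).

Let M1 : M 1. Proof. by case: Malg. Qed.
Let MM x y : M x -> M y -> M (x * y). Proof. by case: Malg => _ _; apply. Qed.
Let Mlin q x y : M x -> M y -> M (ratr q * x + y). Proof. by case: Malg => _ + _; apply. Qed.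

Let M0 : M 0.
Proof. by have := @Mlin (-1) 1 1 M1 M1; rewrite rmorphN1 mulN1r addNr. Qed.

Let MZ q x : M x -> M (ratr q * x).
Proof. by move=> Mx; have := Mlin q Mx M0; rewrite addr0. Qed.

Let MD x y : M x -> M y -> M (x + y).
Proof. by move=> Mx My; have := Mlin 1 Mx My; rewrite rmorph1 mul1r. Qed.

Let MN x : M x -> M (- x).
Proof. by move=> Mx; have := MZ (-1) Mx; rewrite rmorphN1 mulN1r. Qed.

Let Msum n (P : pred 'I_n) (F : 'I_n -> R) :
  (forall i, P i -> M (F i)) -> M (\sum_(i < n | P i) F i).
Proof. by move=> MF; elim/big_ind : _. Qed.

Let Msign k x : M x -> M ((-1) ^+ k * x).
Proof.
by move=> Mx; rewrite -signr_odd; case: (odd k); rewrite ?expr0 ?mul1r ?expr1 ?mulN1r//; exact: MN.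
Qed.

Let Mpow_div_fact k : M (pow_div_fact k.*2).
Proof.
have Mp : M ((pi ^+ 2) ^+ k).
  by elim: k => [|k IH]; rewrite ?expr0// exprS; exact: MM.
have := MZ ((4 ^+ k * k.*2`!%:R)^-1) Mp; congr M.
rewrite fmorphV rmorphM rmorphXn !rmorph_nat /pow_div_fact -mul2n [RHS]mulrC exprM.
rewrite expr_div_n invfM.
have -> : (2 ^+ 2 : R) = 4 by ring.
by rewrite expr_div_n; ring.
Qed.

Let Mpi_beta_odd n : M (pi * beta n.*2.+1).
Proof.
elim/ltn_ind : n => -[|n] IH.
  rewrite dirichlet_beta1; have := MZ 4^-1 Mpi2; congr M.
  by rewrite fmorphV rmorph_nat; ring.
have := beta_cos_sum_even n.
rewrite /beta_cos_sum big_mkcond big_ord_recl/= subn0 expr0 mul1r.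
rewrite {1}/pow_div_fact expr0 fact0 divr1 mulr1 => /eqP.
rewrite addr_eq0 => /eqP ->; rewrite mulrN mulr_sumr; apply/MN/Msum => a _.
rewrite /bump/= add1n; case: ifPn => [ao|]; last by rewrite mulr0.
rewrite /= negbK in ao.
have a2 : a = a./2.*2.+1 :> nat by rewrite -[LHS]odd_double_half ao.
have an := ltn_ord a.
have -> : (n.+1.*2 - a.+1 = (n - a./2).*2)%N by lia.
have -> : (a.+1 = a./2.+1.*2)%N by lia.
have -> (e b q : R) : pi * (e * b * q) = e * (pi * b * q) by ring.
apply: Msign; apply: MM; last exact: Mpow_div_fact.
by apply: IH; rewrite ltnS leq_subr.
Qed.

Lemma multT_in_subalgebra m : M (multT R m.+1).
Proof.
rewrite multT_beta_cos_sum; apply: MD; first exact: Mpi_beta_odd.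
apply: MN; rewrite -[4](ratr_nat R); apply: MZ; apply: Msum => r ro.
have r2 : r = r./2.*2.+1 :> nat by rewrite -[LHS]odd_double_half ro.
have rm := ltn_ord r.
apply: MM; first by rewrite r2 -doubleS; exact: Mbeta.
apply: Msum => a ao.
have a2 : a = a./2.*2 :> nat by rewrite -[LHS]odd_double_half (negbTE ao).
have am := ltn_ord a.
rewrite -mulrA; apply: Msign; apply: MM; last by rewrite a2; exact: Mpow_div_fact.
have -> : ((m.+1.*2 - r - a).+1 = (m.+1 - r./2 - a./2).*2)%N by lia.
by apply: Mbeta; lia.
Qed.

End Membership.

End ClosedFormula.

Unset Implicit Arguments.

Theorem theorem3 (R : realType) (m : nat) (hm : (1 <= m)%N) :
  multT R m =
    \sum_(r < (2 * m).+1) \sum_(p < (2 * m).+1)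
      \sum_(k < (2 * m).+1 | (r + p + 2 * k == 2 * m)%N)
        4 * (-1) ^+ (r + k) * dirichlet_beta R r.+1 * dirichlet_beta R p.+1 *
        ((2 * k)`!%:R^-1 * (pi / 2) ^+ (2 * k))
  /\ rat_subalgebra_gen
       ([set pi ^+ 2] `|`
        [set dirichlet_beta R (2 * k)%N | k in [set k : nat | (1 <= k)%N]])
       (multT R m).
Proof.
split; first exact: multT_triple_sum.
move=> M [Malg GM]; rewrite -(prednK hm).
apply: (multT_in_subalgebra Malg); first by apply: GM; left.
by move=> k k0; apply: GM; right; exists k; rewrite // mul2n.
Qed.
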